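(* If $\tilde w\in\mathbb{O}_{0,\delta}$ and $\ell(\tilde w)=2k$ with $k\in\mathbb{N}$, then $$f_{\tilde w,\mathbb{O}}=\begin{cases}(k-j)(v-v^{-1})^2,&\mathbb{O}=\mathbb{O}_{2j,\delta}\ (1\leq j\leq k-1),\\ k(v-v^{-1}),&\mathbb{O}=\mathbb{O}_{1,\delta},\\ 1,&\mathbb{O}=\mathbb{O}_{0,\delta},\\ 0,&\text{otherwise.}\end{cases}$$
   Context: $W=\langle s_1,s_2\rangle$ is the finite Weyl group of type $A_2$; $\alpha_1,\alpha_2$ are the simple roots, identified with the simple coroots ($\langle\alpha_i,\alpha_i\rangle=2$, $\langle\alpha_1,\alpha_2\rangle=-1$); $Q=\mathbb{Z}\alpha_1\oplus\mathbb{Z}\alpha_2$; $P$ is the coweight lattice; $\widetilde W=P\rtimes W$ with translations $t^\lambda$. $W_a=Q\rtimes W$ is the Coxeter group generated by $s_0=t^{\alpha_1+\alpha_2}s_1s_2s_1$, $s_1$, $s_2$; $\widetilde W=W_a\rtimes\langle\tau\rangle$ with $\tau^3=1$, $\tau s_0\tau^{-1}=s_1$, $\tau s_1\tau^{-1}=s_2$, $\tau s_2\tau^{-1}=s_0$; $\ell(w\tau^j)=\ell(w)$ for $w\in W_a$. $\delta$ is the automorphism of $\widetilde W$ fixing $s_0$ and interchanging $s_1$ and $s_2$ (so $\delta(\tau)=\tau^{-1}$). $\tilde w,\tilde w'$ are $\delta$-conjugate if $\tilde w'=\tilde x\tilde w\delta(\tilde x)^{-1}$ for some $\tilde x\in\widetilde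 W$. $\mathbb{N}$ contains $0$. Class polynomials: $\widetilde H$ is the algebra over $\mathbb{Z}[v,v^{-1}]$ with basis $T_{\tilde w}$ ($\tilde w\in\widetilde W$), $T_{\tilde x}T_{\tilde y}=T_{\tilde x\tilde y}$ if $\ell(\tilde x)+\ell(\tilde y)=\ell(\tilde x\tilde y)$, and $(T_s-v)(T_s+v^{-1})=0$ for $s\in\{s_0,s_1,s_2\}$; $\delta$ acts on $\widetilde H$ by $T_{\tilde w}\mapsto T_{\delta(\tilde w)}$. $[\widetilde H,\widetilde H]_\delta$ is the submodule spanned by all $hh'-h'\delta(h)$. For a $\delta$-conjugacy class $\mathbb{O}$, $T_{\mathbb{O}}$ is the image in $\widetilde H/[\widetilde H,\widetilde H]_\delta$ of $T_w$ for any minimal length $w\in\mathbb{O}$; by He–Nie this is well defined and the $T_{\mathbb{O}}$ form a basis. The class polynomials $f_{\tilde w,\mathbb{O}}$ are the unique coefficients with $T_{\tilde w}\equiv\sum_{\mathbb{O}}f_{\tilde w,\mathbb{O}}T_{\mathbb{O}}\bmod[\widetilde H,\widetilde H]_\delta$. For $X\subset W_a$ put $\widehat X=X\sqcup\{(\tau x\tau^{-1})\tau^2\mid x\in X\}\sqcup\{(\tau^2x\tau^{-2})\tau\mid x\in X\}$. $\delta$-conjugacy classes: $\mathbb{O}_{0,\delta}=\widehat X$ for $X=\{t^{k(\alpha_1+2\alpha_2)}s_2s_1,\ t^{k(2\alpha_1+\alpha_2)}s_1s_2,\ t^{k(\alpha_1-\alpha_2)}\mid k\in\mathbb{Z}\}$;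 $\mathbb{O}_{1,\delta}=\widehat X$ for $X=\{t^\lambda s_1,\ t^\lambda s_2\mid\lambda\in Q\}$; for a positive integer $m$, with $\epsilon(m)=1$ if $m$ is odd and $0$ if $m$ is even, $\mathbb{O}_{2m,\delta}=\widehat X_m$, where $X_m$ consists of the elements, for all $k\in\mathbb{Z}$, $t^{(k-\lfloor m/2\rfloor)\alpha_1+(2k+\epsilon(m))\alpha_2}s_2s_1$, $t^{(k+\lfloor (m+1)/2\rfloor)\alpha_1+(2k+\epsilon(m))\alpha_2}s_2s_1$, $t^{(2k+\epsilon(m))\alpha_1+(k+\lfloor (m+1)/2\rfloor)\alpha_2}s_1s_2$, $t^{(2k+\epsilon(m))\alpha_1+(k-\lfloor m/2\rfloor)\alpha_2}s_1s_2$, $t^{k\alpha_1+(m-k)\alpha_2}$, $t^{(k-m)\alpha_1-k\alpha_2}$. *)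

(* Defs.v *)
From HB Require Import structures.
From mathcomp Require Import all_boot all_order all_algebra all_fingroup.
From mathcomp Require Import boolp classical_sets functions cardinality fsbigop.
From mathcomp Require Import ring.

Set Implicit Arguments.
Unset Strict Implicit.
Unset Printing Implicit Defensive.
Set SsrOldRewriteGoalsOrder.

Import Order.TTheory GRing.Theory Num.Theory.

Local Open Scope classical_set_scope.
Local Open Scope ring_scope.

Local Notation "p %:F" := (@FracField.tofrac _ p).

(** * The ring Z[v, v^-1] *)

(* Realised inside the field of fractions of Z[X], with v = X. *)
Definition laurent_pred : {pred {fraction {poly int}}} :=
  fun x => `[< exists (p : {poly int}) (n : nat), x = p%:F / ('X%:F) ^+ n >].

Lemma tofracX_neq0 n : ('X%:F : {fraction {poly int}}) ^+ n != 0.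
Proof. by rewrite expf_neq0 // tofrac_eq0 polyX_eq0. Qed.

Lemma laurent_pred_subring : subring_closed laurent_pred.
Proof.
split.
- by apply/asboolP; exists 1, 0%N; rewrite expr0 divr1 tofrac1.
- move=> _ _ /asboolP[p [n ->]] /asboolP[q [m ->]]; apply/asboolP.
  exists (p * 'X^m - q * 'X^n), (n + m)%N.
  rewrite tofracB !tofracM !tofracXn exprD mulrBl.
  rewrite -mulf_div divff ?tofracX_neq0// mulr1; congr (_ - _).
  by rewrite (mulrC (_ ^+ n)) -mulf_div divff ?tofracX_neq0// mulr1.
- move=> _ _ /asboolP[p [n ->]] /asboolP[q [m ->]]; apply/asboolP.
  by exists (p * q), (n + m)%N; rewrite tofracM exprD invfM mulrACA.
Qed.

HB.instance Definition _ := GRing.isSubringClosed.Build _ laurent_pred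
  laurent_pred_subring.

Record laurent := Laurent {
  laurent_val :> {fraction {poly int}};
  laurent_valP : laurent_val \in laurent_pred }.

HB.instance Definition _ := [isSub for laurent_val].
HB.instance Definition _ := [Choice of laurent by <:].
HB.instance Definition _ := [SubChoice_isSubComNzRing of laurent by <:].

Definition laurent_unit : {pred laurent} := fun x => `[< exists y, y * x = 1 >].

Definition laurent_inv (x : laurent) : laurent :=
  if pselect (exists y, y * x = 1) is left ex then projT1 (cid ex) else x.

Lemma laurent_mulVr : {in laurent_unit, left_inverse 1 laurent_inv *%R}.
Proof.
move=> x /asboolP ex; rewrite /laurent_inv; case: pselect => // ex'.
by case: (cid ex').
Qed.

Lemma laurent_unitP (x y : laurent) : y * x = 1 -> laurent_unit x.
Proof. by move=> yx; apply/asboolP; exists y. Qed.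

Lemma laurent_inv_out : {in [predC laurent_unit], laurent_inv =1 id}.
Proof.
by move=> x /asboolPn nex; rewrite /laurent_inv; case: pselect.
Qed.

HB.instance Definition _ := GRing.ComNzRing_hasMulInverse.Build laurent
  laurent_mulVr laurent_unitP laurent_inv_out.

Lemma laurent_v_subproof : 'X%:F \in laurent_pred.
Proof. by apply/asboolP; exists 'X, 0%N; rewrite expr0 divr1. Qed.

Definition v : laurent := Laurent laurent_v_subproof.

Lemma v_unit : v \is a GRing.unit.
Proof.
have X1 : ('X%:F)^-1 \in laurent_pred.
  by apply/asboolP; exists 1, 1%N; rewrite tofrac1 div1r expr1.
apply/asboolP; exists (Laurent X1); apply: val_inj => /=.
by rewrite mulVf // -['X%:F]expr1 tofracX_neq0.
Qed.

(** * The coweight lattice and the finite Weyl group *)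

(* [l : coweight] has coordinates (<l, alpha1>, <l, alpha2>), i.e. it is
   l.1 * omega1 + l.2 * omega2 for the fundamental coweights omega_i. *)
Definition coweight := (int * int)%type.

Definition alpha1 : coweight := (2, -1).
Definition alpha2 : coweight := (-1, 2).
Definition omega1 : coweight := (1, 0).
Definition omega2 : coweight := (0, 1).

(* W is the symmetric group S_3. A coweight is the class modulo (1, 1, 1) of the
   vector (l.1 + l.2, l.2, 0) of Z^3, on which [w] acts by permuting
   coordinates: (w m)_i = m_(w i). This is a left action, because (w * w') i
   is w' (w i) for permutations. *)
Definition wvec (l : coweight) (i : 'I_3) : int :=
  tnth [tuple l.1 + l.2; l.2; 0] i.

Definition wact (w : 'S_3) (l : coweight) : coweight :=
  (wvec l (w 0) - wvec l (w 1), wvec l (w 1) - wvec l (w 2)).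

Definition r1 : 'S_3 := tperm 0 1.
Definition r2 : 'S_3 := tperm 1 2.

Lemma ord3P (P : 'I_3 -> Prop) : P 0 -> P 1 -> P 2 -> forall i, P i.
Proof.
move=> P0 P1 P2 [[|[|[|//]]] Hi].
- by rewrite (_ : Ordinal Hi = 0) //; exact: val_inj.
- by rewrite (_ : Ordinal Hi = 1) //; exact: val_inj.
- by rewrite (_ : Ordinal Hi = 2) //; exact: val_inj.
Qed.

Lemma cowD (l m : coweight) : l + m = (l.1 + m.1, l.2 + m.2).
Proof. by case: l => ? ?; case: m. Qed.

Lemma cowN (l : coweight) : - l = (- l.1, - l.2).
Proof. by case: l. Qed.

Lemma cowMz (l : coweight) n : l *~ n = (l.1 * n, l.2 * n).
Proof.
rewrite [LHS]surjective_pairing -!mulrzz.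
by rewrite (raddfMz (@fst int int)) (raddfMz (@snd int int)).
Qed.

(* The Weyl group acts by the expected simple reflections. *)
Lemma wact_r1 l : wact r1 l = l - alpha1 *~ l.1.
Proof.
case: l => a b; rewrite /wact /r1 tpermL tpermR tpermD //.
by rewrite /wvec !(tnth_nth 0) /= cowMz cowN cowD /=; congr pair; ring.
Qed.

Lemma wact_r2 l : wact r2 l = l - alpha2 *~ l.2.
Proof.
case: l => a b; rewrite /wact /r2 tpermL tpermR tpermD //.
by rewrite /wvec !(tnth_nth 0) /= cowMz cowN cowD /=; congr pair; ring.
Qed.

Lemma wvec_wact w l i : wvec (wact w l) i = wvec l (w i) - wvec l (w 2).
Proof.
by elim/ord3P: i; rewrite {1}/wvec (tnth_nth 0) /= ?subrr // addrA subrK.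
Qed.

Lemma wact1 l : wact 1%g l = l.
Proof.
by case: l => a b; rewrite /wact !perm1 /wvec !(tnth_nth 0) /= addrK subr0.
Qed.

Lemma wactM w w' l : wact (w * w')%g l = wact w (wact w' l).
Proof.
by rewrite {2}/wact !wvec_wact /wact !permM; congr pair; ring.
Qed.

Lemma wactD w l m : wact w (l + m) = wact w l + wact w m.
Proof.
have wvecD i : wvec (l + m) i = wvec l i + wvec m i.
  by elim/ord3P: i; rewrite /wvec !(tnth_nth 0) /= ?addr0// addrACA.
by rewrite /wact !wvecD cowD /=; congr pair; ring.
Qed.

(** * The extended affine Weyl group *)

(* The element [Wext l w] of the semidirect product is t^l w. *)
Record wext := Wext { wtr : coweight; wfin : 'S_3 }.

Definition wext_pair x := (wtr x, wfin x).
Lemma wext_pairK : cancel wext_pair (fun p => Wext p.1 p.2).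
Proof. by case. Qed.

HB.instance Definition _ := Choice.copy wext (can_type wext_pairK).

Definition wmul x y :=
  Wext (wtr x + wact (wfin x) (wtr y)) (wfin x * wfin y)%g.
Definition wone := Wext 0 1%g.
Definition winv x := Wext (- wact (wfin x)^-1%g (wtr x)) (wfin x)^-1%g.

Lemma wmulA : associative wmul.
Proof.
by move=> x y z; rewrite /wmul /= wactD wactM addrA mulgA.
Qed.

Lemma wmul1 : left_id wone wmul.
Proof. by case=> l w; rewrite /wmul /= wact1 add0r mul1g. Qed.

Lemma wact0 w : wact w 0 = 0.
Proof. by apply: (addrI (wact w 0)); rewrite -wactD !addr0. Qed.

Lemma wactN w l : wact w (- l) = - wact w l.
Proof. by apply: (addrI (wact w l)); rewrite -wactD !subrr wact0. Qed.

Lemma wmulr1 : right_id wone wmul.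
Proof. by case=> l w; rewrite /wmul /= wact0 addr0 mulg1. Qed.

Lemma wmulV : left_inverse wone winv wmul.
Proof. by case=> l w; rewrite /wmul /= addNr mulVg. Qed.

Lemma wmulrV : right_inverse wone winv wmul.
Proof.
by case=> l w; rewrite /wmul /= wactN -wactM mulgV wact1 subrr.
Qed.

HB.instance Definition _ :=
  isGroup.Build wext wmulA wmul1 wmulr1 wmulV wmulrV.

Definition trans (l : coweight) : wext := Wext l 1%g.
Definition s1 : wext := Wext 0 r1.
Definition s2 : wext := Wext 0 r2.
Definition s0 : wext := (trans (alpha1 + alpha2) * s1 * s2 * s1)%g.

Definition tau : wext := (trans omega1 * s1 * s2)%g.

Definition srefl (i : 'I_3) : wext := tnth [tuple s0; s1; s2] i.

Lemma wextP (x y : wext) :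
  wtr x = wtr y -> wfin x =1 wfin y -> x = y.
Proof. by case: x y => [l w] [m u] /= -> /permP ->. Qed.

Lemma wmulE (x y : wext) : (x * y)%g = wmul x y. Proof. by []. Qed.

Lemma wact_r1E l : wact r1 l = (- l.1, l.1 + l.2).
Proof. by rewrite wact_r1 cowMz cowN cowD /=; congr pair; ring. Qed.

Lemma wact_r2E l : wact r2 l = (l.1 + l.2, - l.2).
Proof. by rewrite wact_r2 cowMz cowN cowD /=; congr pair; ring. Qed.

Local Ltac wext_compute :=
  rewrite ?/tau ?/s0; apply: wextP;
  [ rewrite /= ?(wactM, wact1, mul1g) ?(wact_r1E, wact_r2E)
  | apply: ord3P; rewrite /= ?(mul1g, mulg1) ?permM ?permE ].

Lemma tau3 : (tau * tau * tau = 1)%g.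
Proof. by wext_compute. Qed.

Lemma tau_s0 : (tau * s0 * tau^-1 = s1)%g.
Proof. by apply/(canLR (mulgK _)); wext_compute. Qed.

Lemma tau_s1 : (tau * s1 * tau^-1 = s2)%g.
Proof. by apply/(canLR (mulgK _)); wext_compute. Qed.

Lemma tau_s2 : (tau * s2 * tau^-1 = s0)%g.
Proof. by apply/(canLR (mulgK _)); wext_compute. Qed.

(* The diagram automorphism: it exchanges alpha1 and alpha2, hence omega1 and
   omega2, and conjugates W by its longest element s1 s2 s1, which exchanges s1
   and s2. *)
Definition delta_cow (l : coweight) : coweight := (l.2, l.1).
Definition delta (x : wext) : wext :=
  Wext (delta_cow (wtr x)) (wfin x ^ (r1 * r2 * r1))%g.

Lemma longest_tperm : (r1 * r2 * r1 = tperm 0 2)%g.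
Proof. by apply/permP; apply: ord3P; rewrite !permM !permE. Qed.

Lemma wvec_delta l i : wvec (delta_cow l) i = l.1 + l.2 - wvec l (tperm 0 2 i).
Proof.
by elim/ord3P: i; rewrite permE /wvec !(tnth_nth 0) /=; ring.
Qed.

Lemma delta_wact w l :
  delta_cow (wact w l) = wact (w ^ (r1 * r2 * r1))%g (delta_cow l).
Proof.
rewrite longest_tperm /wact !wvec_delta /conjg tpermV !permM !tpermK.
by rewrite tpermL tpermR tpermD // /delta_cow /=; congr pair; ring.
Qed.

Lemma deltaM : {morph delta : x y / (x * y)%g}.
Proof.
move=> [l w] [m u]; rewrite /delta /= !wmulE /wmul /= conjMg -delta_wact.
by rewrite !cowD.
Qed.

Lemma deltaK : involutive delta.
Proof.
case=> [[a b] w]; rewrite /delta /= -conjgM longest_tperm.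
by rewrite (tperm2 0 2) conjg1.
Qed.

Lemma delta_trans l : delta (trans l) = trans (delta_cow l).
Proof. by rewrite /delta /= conj1g. Qed.

Lemma delta_s1 : delta s1 = s2.
Proof. by rewrite /delta longest_tperm /conjg tpermV; wext_compute. Qed.

Lemma delta_s2 : delta s2 = s1.
Proof. by rewrite /delta longest_tperm /conjg tpermV; wext_compute. Qed.

Lemma delta_s0 : delta s0 = s0.
Proof.
by rewrite /s0 !deltaM delta_trans delta_s1 delta_s2; wext_compute.
Qed.

Lemma delta_tau : delta tau = (tau^-1)%g.
Proof.
apply: (mulIg tau); rewrite mulVg.
by rewrite {1}/tau !deltaM delta_trans delta_s1 delta_s2; wext_compute.
Qed.

(** * The length function *)

Definition expression (u : seq 'I_3) (j : nat) : wext :=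
  ((\prod_(i <- u) srefl i) * tau ^+ j)%g.

Definition has_expression (x : wext) (n : nat) : bool :=
  `[< exists u j, size u = n /\ x = expression u j >].

Section ExpressionExists.
Let E (x : wext) := exists u j, x = expression u j.
Let G (x : wext) := forall y, E y -> E (x * y)%g.

Let GM x y : G x -> G y -> G (x * y)%g.
Proof. by move=> Gx Gy z Ez; rewrite -mulgA; apply/Gx/Gy. Qed.

Let Gs i : G (srefl i).
Proof.
by move=> _ [u [j ->]]; exists (i :: u), j; rewrite /expression big_cons mulgA.
Qed.

Let tau_srefl i : (tau * srefl i = srefl (i + 1) * tau)%g.
Proof.
apply/(canRL (mulgKV _)).
by elim/ord3P: i; rewrite /srefl !(tnth_nth s0) /= (tau_s0, tau_s1, tau_s2).
Qed.

Let Gt : G tau.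
Proof.
move=> _ [u [j ->]]; exists [seq i + 1 | i <- u], j.+1.
rewrite /expression expgS mulgA [RHS]mulgA; congr (_ * _)%g.
elim: u => [|i u IH] /=; first by rewrite !big_nil mul1g mulg1.
by rewrite !big_cons mulgA tau_srefl -[LHS]mulgA IH [LHS]mulgA.
Qed.

Let Gs1 : G s1. Proof. exact: (Gs 1). Qed.
Let Gs2 : G s2. Proof. exact: (Gs 2). Qed.

Let Gtrans_mul l n :
  G (trans l) -> G (trans (- l)) -> G (trans (l *~ n)).
Proof.
have transD a b : trans (a + b) = (trans a * trans b)%g.
  by rewrite wmulE /wmul /= wact1 mulg1.
have Gn (a : coweight) k : G (trans a) -> G (trans (a *+ k)).
  move=> Ga; elim: k => [|k IH]; first by rewrite mulr0n => y; rewrite mul1g.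
  by rewrite mulrS transD; apply: GM.
case: n => k Gl GNl; first exact: Gn.
by rewrite NegzE mulrNz -mulNrz; apply: Gn.
Qed.

Let Gtrans l : G (trans l).
Proof.
have -> : trans l = (trans (omega1 *~ l.1) * trans (omega2 *~ l.2))%g.
  rewrite wmulE /wmul /= wact1 mulg1; congr Wext.
  by rewrite !cowMz cowD /=; case: l => a b /=; congr pair; ring.
have G1 : G (trans omega1).
  have -> : trans omega1 = (tau * s2 * s1)%g by wext_compute.
  exact: (GM (GM Gt Gs2) Gs1).
have G2 : G (trans omega2).
  have -> : trans omega2 = (tau * tau * s1 * s2)%g by wext_compute.
  exact: (GM (GM (GM Gt Gt) Gs1) Gs2).
have G1' : G (trans (- omega1)).
  have -> : trans (- omega1) = (s1 * s2 * tau * tau)%g by wext_compute.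
  exact: (GM (GM (GM Gs1 Gs2) Gt) Gt).
have G2' : G (trans (- omega2)).
  have -> : trans (- omega2) = (s2 * s1 * tau)%g by wext_compute.
  exact: (GM (GM Gs2 Gs1) Gt).
by apply: GM; apply: Gtrans_mul.
Qed.

Let Gfin (w : 'S_3) : G (Wext 0 w).
Proof.
have finM (a b : 'S_3) : Wext 0 (a * b)%g = (Wext 0 a * Wext 0 b)%g.
  by rewrite wmulE /wmul /= wact0 addr0.
have Gtp i j : G (Wext 0 (tperm i j)).
  have G1 : G (Wext 0 1%g) by move=> y; rewrite mul1g.
  have G02 : G (Wext 0 (tperm 0 2)).
    by rewrite -longest_tperm !finM; exact: (GM (GM Gs1 Gs2) Gs1).
  elim/ord3P: i; elim/ord3P: j; rewrite ?tperm1 //;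
    first [exact: Gs1 | exact: Gs2 | by rewrite tpermC].
case: (prod_tpermP w) => ts -> _; elim: ts => [|t ts IH].
  by rewrite big_nil => y; rewrite mul1g.
by rewrite big_cons finM; apply: GM.
Qed.

Lemma has_expression_ex x : exists n, has_expression x n.
Proof.
have [u [j ->]] : E x.
  have -> : x = (trans (wtr x) * Wext 0 (wfin x) * 1)%g.
    by case: x => l w; rewrite mulg1 wmulE /wmul /= wact1 addr0 mul1g.
  apply: GM; [exact: Gtrans | exact: Gfin |].
  by exists [::], 0%N; rewrite /expression big_nil expg0 mulg1.
by exists (size u); apply/asboolP; exists u, j.
Qed.

End ExpressionExists.

(* The affine Weyl group W_a is generated by s0, s1, s2, and x = y * tau^j with y
   in W_a; so [len x] is the Coxeter length of y. *)
Definition len (x : wext) : nat := ex_minn (has_expression_ex x).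

(** * delta-conjugacy classes *)

Definition dconj (x y : wext) : Prop := exists z, y = (z * x * (delta z)^-1)%g.

Definition dclasses : set (set wext) := range (fun x => [set y | dconj x y]).

Definition min_reps (r : set wext -> wext) : Prop :=
  forall O, dclasses O -> O (r O) /\ forall y, O y -> (len (r O) <= len y)%N.

Definition hat (X : set wext) : set wext :=
  X `|` [set (tau * x * tau^-1 * tau ^+ 2)%g | x in X]
    `|` [set (tau ^+ 2 * x * tau ^- 2 * tau)%g | x in X].

Definition transQ (a b : int) : wext := trans (alpha1 *~ a + alpha2 *~ b).

Definition O0 : set wext := hat
  (range (fun k : int => (transQ k (2 * k)%R * s2 * s1)%g)
   `|` range (fun k : int => (transQ (2 * k)%R k * s1 * s2)%g)
   `|` range (fun k : int => transQ k (- k))).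

Definition O1 : set wext := hat
  ([set x | exists a b, x = (transQ a b * s1)%g]
   `|` [set x | exists a b, x = (transQ a b * s2)%g]).

(* [Oeven m] is the class O_{2m,delta}; this is meant for m > 0 only. *)
Definition Oeven (m : nat) : set wext :=
  let e : int := (odd m)%:Z in
  let lo : int := (m./2)%:Z in
  let hi : int := (uphalf m)%:Z in
  hat
  (range (fun k : int => (transQ (k - lo)%R (2 * k + e)%R * s2 * s1)%g)
   `|` range (fun k : int => (transQ (k + hi)%R (2 * k + e)%R * s2 * s1)%g)
   `|` range (fun k : int => (transQ (2 * k + e)%R (k + hi)%R * s1 * s2)%g)
   `|` range (fun k : int => (transQ (2 * k + e)%R (k - lo)%R * s1 * s2)%g)
   `|` range (fun k : int => transQ k (m%:Z - k))
   `|` range (fun k : int => transQ (k - m%:Z) (- k))).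

(** * The Iwahori-Hecke algebra and class polynomials *)

(* The algebra is determined up to unique isomorphism by these data. The basis
   property says that every element is a unique finite linear combination. *)
Record hecke := Hecke {
  hecke_alg :> algType laurent;
  T : wext -> hecke_alg;
  T_basis : forall h, exists! c : wext -> laurent,
    finite_set [set w | c w != 0] /\ h = \sum_(w \in setT) c w *: T w;
  T_mul : forall x y, (len x + len y)%N = len (x * y)%g ->
    T x * T y = T (x * y)%g;
  T_quad : forall i : 'I_3,
    (T (srefl i) - v%:A) * (T (srefl i) + (v^-1)%:A) = 0;
  hdelta : {linear hecke_alg -> hecke_alg};
  hdelta_T : forall w, hdelta (T w) = T (delta w) }.

Arguments T : clear implicits.
Arguments hdelta : clear implicits.

Definition dcommutators (H : hecke) : set H :=
  [set z | exists u : seq (laurent * H * H),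
    z = \sum_(p <- u) p.1.1 *: (p.1.2 * p.2 - p.2 * hdelta H p.1.2)].

(* [f] is a family of coefficients expressing the image of T_w in the twisted
   cocenter in terms of the T_(r O), O ranging over the delta-conjugacy classes;
   the values of [f] outside [dclasses] are irrelevant. *)
Definition class_polynomials (H : hecke) (r : set wext -> wext) (w : wext)
    (f : set wext -> laurent) : Prop :=
  finite_set [set O | dclasses O /\ f O != 0] /\
  dcommutators (T H w - \sum_(O \in dclasses) f O *: T H (r O)).

(* Main.v *)
From HB Require Import structures.
Require Import Defs.
From mathcomp Require Import all_boot all_order all_algebra all_fingroup.
From mathcomp Require Import boolp classical_sets functions cardinality fsbigop.
From mathcomp Require Import zify ring.

(* A delta-class is determined by a glide length m (the finite part of w is
   even), by w having finite part s1 or s2, or by the parity of the translation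
   part of w (finite part the longest element). Reducing T_w by conjugation with
   simple reflections gives the stated expansion. For its uniqueness we need
   linear independence of the T_O: for arbitrarily prescribed values [val] on the
   classes there is an explicit function [phi val] on the extended affine Weyl
   group, [T w |-> phi val w] kills the twisted commutators, and it takes the value
   [val c] on every minimal length element of the class [c]. On the first two kinds
   of elements phi depends only on the class and the length; on t^l w_0 it is a
   sum over the positive roots alpha of a function of |<l, alpha> - 1|, plus a
   function of the length. *)

Set Implicit Arguments.
Unset Strict Implicit.
Unset Printing Implicit Defensive.

Import Order.TTheory GRing.Theory Num.Theory.

Local Open Scope classical_set_scope.
Local Open Scope ring_scope.

(** * Coordinates and the length formula *)

(** An explicit enumeration of W lets products, actions and lengths compute by cases, so that most
    claims become linear integer arithmetic. *)
Inductive fin6 := E | S1 | S2 | S12 | S21 | W0.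

Definition fperm (u : fin6) : 'S_3 :=
  match u with
  | E => 1 | S1 => r1 | S2 => r2 | S12 => r1 * r2 | S21 => r2 * r1
  | W0 => r1 * r2 * r1
  end%g.

Definition fcode (w : 'S_3) : fin6 :=
  match nat_of_ord (w 0), nat_of_ord (w 1) with
  | 0%N, 1%N => E | 1%N, 0%N => S1 | 0%N, _ => S2 | 1%N, _ => S21
  | _, 0%N => S12 | _, _ => W0
  end.

Definition fmul (u w : fin6) : fin6 :=
  match u, w with
  | E, x | x, E => x
  | S1, S1 => E | S1, S2 => S12 | S1, S12 => S2 | S1, S21 => W0 | S1, W0 => S21
  | S2, S1 => S21 | S2, S2 => E | S2, S12 => W0 | S2, S21 => S1 | S2, W0 => S12
  | S12, S1 => W0 | S12, S2 => S1 | S12, S12 => S21 | S12, S21 => E | S12, W0 => S2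
  | S21, S1 => S2 | S21, S2 => W0 | S21, S12 => E | S21, S21 => S12 | S21, W0 => S1
  | W0, S1 => S12 | W0, S2 => S21 | W0, S12 => S1 | W0, S21 => S2 | W0, W0 => E
  end.

Definition fact1 (u : fin6) (a b : int) : int :=
  match u with
  | E => a | S1 => - a | S2 => a + b | S12 => - (a + b) | S21 => b | W0 => - b
  end.
Definition fact2 (u : fin6) (a b : int) : int :=
  match u with
  | E => b | S1 => a + b | S2 => - b | S12 => a | S21 => - (a + b) | W0 => - a
  end.

Definition fdelta (u : fin6) : fin6 :=
  match u with
  | E => E | S1 => S2 | S2 => S1 | S12 => S21 | S21 => S12 | W0 => W0
  end.

(* t^(a omega1 + b omega2) u *)
Definition elt (a b : int) (u : fin6) : wext := Wext (a, b) (fperm u).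

Lemma fpermK : cancel fperm fcode.
Proof. by case; rewrite /fcode /fperm ?permM !permE. Qed.

Lemma fpermM u w : fperm (fmul u w) = (fperm u * fperm w)%g.
Proof.
by apply/permP; apply: ord3P; case: u; case: w; rewrite /= ?permM !permE.
Qed.

Lemma fcodeK : cancel fcode fperm.
Proof.
have ord3 (i : 'I_3) : [\/ i = 0, i = 1 | i = 2].
  by elim/ord3P: i; [exact: Or31 | exact: Or32 | exact: Or33].
move=> w; apply/permP => i.
have [] : [/\ w 0 != w 1, w 0 != w 2 & w 1 != w 2].
  by rewrite !(inj_eq perm_inj).
rewrite /fcode; case: (ord3 (w 0)) => e0; case: (ord3 (w 1)) => e1;
case: (ord3 (w 2)) => e2; rewrite e0 e1 e2 // => _ _ _;
by elim/ord3P: i; rewrite /= ?permM !permE ?e0 ?e1 ?e2.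
Qed.

Lemma wact_fperm u a b : wact (fperm u) (a, b) = (fact1 u a b, fact2 u a b).
Proof.
by case: u; rewrite /= ?(wactM, wact1) ?(wact_r1E, wact_r2E) //=; congr pair; ring.
Qed.

Lemma eltM a b u c d w :
  (elt a b u * elt c d w)%g = elt (a + fact1 u c d) (b + fact2 u c d) (fmul u w).
Proof. by rewrite wmulE /wmul /= wact_fperm cowD /elt fpermM. Qed.

Lemma delta_elt a b u : delta (elt a b u) = elt b a (fdelta u).
Proof.
rewrite /delta longest_tperm /elt; congr Wext; apply/permP.
by apply: ord3P; case: u; rewrite /conjg tpermV /= ?permM !permE.
Qed.

Lemma s0E : s0 = elt 1 1 W0.
Proof.
have -> : s0 = (elt 1 1 E * elt 0 0 S1 * elt 0 0 S2 * elt 0 0 S1)%g.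
  by rewrite /s0 /trans /alpha1 /alpha2 cowD.
by rewrite !eltM.
Qed.
Lemma s1E : s1 = elt 0 0 S1. Proof. by []. Qed.
Lemma s2E : s2 = elt 0 0 S2. Proof. by []. Qed.
Lemma tauE : tau = elt 1 0 S12.
Proof.
have -> : tau = (elt 1 0 E * elt 0 0 S1 * elt 0 0 S2)%g by [].
by rewrite !eltM.
Qed.
Lemma tauVE : (tau^-1)%g = elt 0 1 S21.
Proof. by rewrite -delta_tau tauE delta_elt. Qed.
Lemma oneE : 1%g = elt 0 0 E. Proof. by []. Qed.

Variant elt_spec : wext -> Type := EltSpec a b u : elt_spec (elt a b u).
Lemma eltP x : elt_spec x.
Proof. by case: x => [[a b] w]; rewrite -(fcodeK w); exact: EltSpec. Qed.

(* Iwahori-Matsumoto: the sum over the positive roots alpha of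
   |<l, alpha> - [u^-1 alpha < 0]|. *)
Definition elln (a b : int) (u : fin6) : nat :=
  match u with
  | E => `|a| + `|b| + `|(a + b)%R|
  | S1 => `|(a - 1)%R| + `|b| + `|(a + b)%R|
  | S2 => `|a| + `|(b - 1)%R| + `|(a + b)%R|
  | S12 => `|(a - 1)%R| + `|b| + `|(a + b - 1)%R|
  | S21 => `|a| + `|(b - 1)%R| + `|(a + b - 1)%R|
  | W0 => `|(a - 1)%R| + `|(b - 1)%R| + `|(a + b - 1)%R|
  end%N.
Definition ell (x : wext) : nat := elln (wtr x).1 (wtr x).2 (fcode (wfin x)).

Lemma ellE a b u : ell (elt a b u) = elln a b u.
Proof. by rewrite /ell /= fpermK. Qed.

(** * The combinatorial formula is the Coxeter length *)

Lemma srefl0 : srefl 0 = s0. Proof. by rewrite /srefl (tnth_nth s0). Qed.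
Lemma srefl1 : srefl 1 = s1. Proof. by rewrite /srefl (tnth_nth s0). Qed.
Lemma srefl2 : srefl 2 = s2. Proof. by rewrite /srefl (tnth_nth s0). Qed.
Definition sreflE := (srefl0, srefl1, srefl2).

Lemma srefl_sq i : (srefl i * srefl i = 1)%g.
Proof. by elim/ord3P: i; rewrite sreflE ?s0E ?s1E ?s2E eltM. Qed.

Lemma ell_srefl i x : (ell (srefl i * x)%g <= (ell x).+1)%N.
Proof.
elim/ord3P: i; rewrite sreflE ?s0E ?s1E ?s2E; case: (eltP x) => a b u;
  rewrite eltM; case: u; rewrite !ellE /=; lia.
Qed.

Lemma ell_tau x : ell (tau * x)%g = ell x.
Proof.
rewrite tauE; case: (eltP x) => a b u; rewrite eltM; case: u; rewrite !ellE /=; lia.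
Qed.

Lemma ell_eq0 x : ell x = 0%N -> exists j, x = (tau ^+ j)%g.
Proof.
case: (eltP x) => a b u; case: u; rewrite !ellE /= => h; try (by exfalso; lia).
- have [-> ->] : a = 0 /\ b = 0 by clear -h; lia.
  by exists 0%N.
- have [-> ->] : a = 1 /\ b = 0 by clear -h; lia.
  by exists 1%N; rewrite expg1 tauE.
- have [-> ->] : a = 0 /\ b = 1 by clear -h; lia.
  by exists 2%N; rewrite expgS expg1 tauE eltM.
Qed.

Lemma ell_descent x n : ell x = n.+1 -> exists i, ell (srefl i * x)%g = n.
Proof.
move=> h; suff : ell (s0 * x)%g = n \/ ell (s1 * x)%g = n \/ ell (s2 * x)%g = n.
  by case=> [|[]] <-; [exists 0|exists 1|exists 2]; rewrite sreflE.
rewrite s0E s1E s2E; move: h; case: (eltP x) => a b u; rewrite !eltM.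
by case: u; rewrite !ellE /= => h; lia.
Qed.

Lemma ell_tauX j x : ell (tau ^+ j * x)%g = ell x.
Proof.
by elim: j => [|j IH]; rewrite ?mul1g // expgS -mulgA ell_tau.
Qed.

Lemma ell_expression u j : (ell (expression u j) <= size u)%N.
Proof.
rewrite /expression; elim: u => [|i u IH].
  by rewrite big_nil mul1g -(mulg1 (tau ^+ j)%g) ell_tauX oneE ellE.
by rewrite big_cons -mulgA /=; apply: leq_trans (ell_srefl _ _) _.
Qed.

Lemma expression_ell x : exists u j, size u = ell x /\ x = expression u j.
Proof.
elim: {x}(ell x) {-2}x (erefl (ell x)) => [|n IH] x ex.
  have [j xj] := ell_eq0 ex; exists [::], j.
  by rewrite ex /expression big_nil mul1g.
have [i ei] := ell_descent ex; have [u [j [su eu]]] := IH _ ei.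
exists (i :: u), j; split; first by rewrite ex /= su ei.
rewrite /expression big_cons -mulgA.
by move: eu; rewrite /expression => <-; rewrite mulgA srefl_sq mul1g.
Qed.

(** A letter raises [ell] by at most one and [tau] preserves it, so [ell x] bounds every expression
    from below; repeated descents produce an expression of exactly that size. *)
Lemma lenE x : len x = ell x.
Proof.
rewrite /len; case: ex_minnP => n /asboolP[u [j [<- xE]]] min.
apply/eqP; rewrite eqn_leq {2}xE ell_expression andbT; apply: min.
by apply/asboolP; have [w [k [sw xw]]] := expression_ell x; exists w, k.
Qed.

Lemma len_elt a b u : len (elt a b u) = elln a b u.
Proof. by rewrite lenE ellE. Qed.

Lemma tauX3 : (tau ^+ 3 = 1)%g.
Proof. by rewrite !expgS expg0 mulg1 mulgA tau3. Qed.

Lemma tauVX : (tau^-1 = tau ^+ 2)%g.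
Proof. by apply: (mulgI tau); rewrite mulgV -expgS tauX3. Qed.

Lemma srefl_tauX i : srefl i = (tau ^+ i * s0 * tau ^- i)%g.
Proof.
elim/ord3P: i; rewrite sreflE /=.
- by rewrite mul1g invg1 mulg1.
- by rewrite expg1 tau_s0.
- by rewrite -tau_s1 -tau_s0 -expVgn !expgS !expg0 !mulg1 !mulgA.
Qed.

(** Every simple reflection is a [tau]-conjugate of [s0], and [tau^-1] is a power of [tau].
    Invariance proofs thus reduce to [s0], fixed by [delta], and [tau], inverted by it. *)
Lemma wext_gen_ind (P : wext -> Prop) :
  P 1%g -> (forall x, P x -> P (s0 * x)%g) -> (forall x, P x -> P (tau * x)%g) ->
  forall x, P x.
Proof.
move=> P1 Ps0 Pt x.
have PtX j y : P y -> P (tau ^+ j * y)%g.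
  by move=> Py; elim: j => [|j IH]; rewrite ?mul1g // expgS -mulgA; exact: Pt.
have [u [j [_ ->]]] := expression_ell x.
rewrite /expression; elim: u => [|i u IH].
  by rewrite big_nil mul1g -(mulg1 (tau ^+ j)%g); exact: PtX.
rewrite big_cons -mulgA; move: (_ * _)%g IH => y Py.
rewrite srefl_tauX -(mulgA _ _ y) -(mulgA _ s0).
have -> : (tau ^- i = tau ^+ (2 * i))%g by rewrite -expVgn tauVX -expgM.
exact/PtX/Ps0/PtX.
Qed.

(** * Classification of the delta-conjugacy classes *)

(* [Even m] is O_{2m}, [Odd1] is O_1; [Half0] and [Half1] are the classes of
   s1 s2 s1 and s0, where w delta acts on the plane as a point reflection. *)
Inductive wclass := Even of nat | Odd1 | Half0 | Half1.

Definition eltclass (a b : int) (u : fin6) : wclass :=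
  match u with
  | E => Even `|(a + b)%R|
  | S12 => Even `|b|
  | S21 => Even `|a|
  | S1 | S2 => Odd1
  | W0 => if odd `|a| || odd `|b| then Half1 else Half0
  end.

Definition class_of (x : wext) : wclass :=
  eltclass (wtr x).1 (wtr x).2 (fcode (wfin x)).

Lemma class_elt a b u : class_of (elt a b u) = eltclass a b u.
Proof. by rewrite /class_of /= fpermK. Qed.

Lemma class_s0 x : class_of (s0 * x * s0)%g = class_of x.
Proof.
rewrite s0E; case: (eltP x) => a b u; rewrite !eltM !class_elt.
by case: u => //=; try (congr Even; lia); congr (if _ then _ else _); lia.
Qed.

Lemma class_tau x : class_of (tau * x * tau)%g = class_of x.
Proof.
rewrite tauE; case: (eltP x) => a b u; rewrite !eltM !class_elt.
by case: u => //=; try (congr Even; lia); congr (if _ then _ else _); lia.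
Qed.

Lemma deltaV x : (delta x^-1 = (delta x)^-1)%g.
Proof.
apply: (mulIg (delta x)); rewrite -deltaM !mulVg.
by rewrite oneE delta_elt.
Qed.

Lemma srefl0V : (s0^-1 = s0)%g.
Proof. by apply: (mulgI s0); rewrite mulgV -srefl0 srefl_sq. Qed.

(** For the generators [s0] and [tau], delta-conjugation is x -> s0 x s0 and x -> tau x tau. *)
Lemma class_dconj x y : dconj x y -> class_of y = class_of x.
Proof.
case=> z ->; elim/wext_gen_ind: z x => [|z IH|z IH] x.
- by rewrite mul1g oneE delta_elt -oneE invg1 mulg1.
- rewrite deltaM delta_s0 invMg srefl0V -(IH x) -[RHS]class_s0.
  by rewrite !mulgA.
- rewrite deltaM delta_tau invMg invgK -(IH x) -[RHS]class_tau.
  by rewrite !mulgA.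
Qed.

Lemma dconj_sym x y : dconj x y -> dconj y x.
Proof.
by case=> z ->; exists z^-1%g; rewrite deltaV invgK !mulgA mulVg mul1g mulgKV.
Qed.

Lemma dconj_trans x y z : dconj x y -> dconj y z -> dconj x z.
Proof.
by case=> t -> [u ->]; exists (u * t)%g; rewrite deltaM invMg !mulgA.
Qed.

Lemma dconj_tau x : dconj x (tau * x * tau)%g.
Proof. by exists tau; rewrite delta_tau invgK. Qed.

Lemma dconj_s0 x : dconj x (s0 * x * s0)%g.
Proof. by exists s0; rewrite delta_s0 srefl0V. Qed.

Lemma dconj_s1 x : dconj x (s1 * x * s2)%g.
Proof.
exists s1; congr (_ * _)%g; rewrite delta_s1.
by apply: (mulIg s2); rewrite mulVg -srefl2 srefl_sq.
Qed.

Lemma dconj_s2 x : dconj x (s2 * x * s1)%g.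
Proof.
exists s2; congr (_ * _)%g; rewrite delta_s2.
by apply: (mulIg s1); rewrite mulVg -srefl1 srefl_sq.
Qed.

(** Conjugation by a translation adds an element of the image of 1 - u delta: all of P for u = s1,
    s2, the sublattice 2P for the longest element, the multiples of (1, -1) for u = 1. *)
Lemma dconj_trans_elt p q a b u :
  dconj (elt a b u) (elt (a + p - fact1 u q p) (b + q - fact2 u q p) u).
Proof.
exists (elt p q E); have -> : ((delta (elt p q E))^-1 = elt (- q) (- p) E)%g.
  by apply: (mulIg (elt q p E)); rewrite delta_elt mulVg eltM !addNr.
rewrite !eltM; case: u; congr elt => /=; ring.
Qed.

Lemma dconj_elt_eq a b c d a' b' c' d' u w :
  dconj (elt a b u) (elt c d w) -> a = a' -> b = b' -> c = c' -> d = d' ->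
  dconj (elt a' b' u) (elt c' d' w).
Proof. by move=> h <- <- <- <-. Qed.

Definition class_rep (c : wclass) : wext :=
  match c with
  | Even m => elt 0 m E
  | Odd1 => elt 0 1 S2
  | Half1 => s0
  | Half0 => elt 0 0 W0
  end.

(** Translations slide (a, b) along the line of constant a + b; conjugation by [s0] gives (-b, -a),
    which settles the sign. *)
Lemma dconj_even a b n : `|(a + b)%R|%N = n -> dconj (elt a b E) (elt 0 n E).
Proof.
have to0 c d : dconj (elt c d E) (elt 0 (c + d) E).
  by apply: (dconj_elt_eq (dconj_trans_elt (- c) 0 c d E)) => /=; ring.
move=> <-; have [ab|ab] := lerP 0 (a + b); first by rewrite gez0_abs.
apply: dconj_trans (dconj_s0 _) _; rewrite s0E !eltM /= ltz0_abs //.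
by apply: (dconj_elt_eq (to0 (- b) (- a))) => /=; ring.
Qed.

Lemma dconj_class_rep x : dconj x (class_rep (class_of x)).
Proof.
case: (eltP x) => a b u; rewrite class_elt.
case: u => /=.
- exact: dconj_even erefl.
- apply: dconj_trans (dconj_s1 _) _; rewrite s1E s2E !eltM /=.
  by apply: (dconj_elt_eq (dconj_trans_elt (1 - b) (- a) (- a) (a + b) S2)) => /=; ring.
- by apply: (dconj_elt_eq (dconj_trans_elt (1 - b - a) a a b S2)) => /=; ring.
(* One conjugation by [tau] takes the finite part s1 s2 to 1; two take s2 s1 to 1. *)
- apply: dconj_trans (dconj_tau _) _; rewrite tauE !eltM /=.
  by apply: dconj_even; lia.
- apply: dconj_trans (dconj_tau _) _; apply: dconj_trans (dconj_tau _) _.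
  rewrite tauE !eltM /=.
  by apply: dconj_even; lia.
(* Translations account for 2P; [s1] and [s2] link the three nonzero parities. *)
- have shift (c d p q : int) : dconj (elt c d W0) (elt (c + 2 * p) (d + 2 * q) W0).
    by apply: (dconj_elt_eq (dconj_trans_elt p q c d W0)) => /=; ring.
  have parity (c : int) : exists c' : int, c = 2 * c' \/ c = 2 * c' + 1.
    by exists (c %/ 2)%Z; lia.
  have [a' [->|->]] := parity a; have [b' [->|->]] := parity b.
  + have -> /= : odd `|(2 * a')%R|%N || odd `|(2 * b')%R|%N = false by lia.
    by apply: (dconj_elt_eq (shift (2 * a') (2 * b') (- a') (- b'))) => /=; ring.
  + have -> /= : odd `|(2 * a')%R|%N || odd `|(2 * b' + 1)%R|%N by lia.
    rewrite s0E; apply: dconj_trans (dconj_s2 _) _; rewrite s1E s2E !eltM /=.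
    apply: (dconj_elt_eq (shift (2 * a' + (2 * b' + 1)) (- (2 * b' + 1))
      (- a' - b') (b' + 1))) => /=; ring.
  + have -> /= : odd `|(2 * a' + 1)%R|%N || odd `|(2 * b')%R|%N by lia.
    rewrite s0E; apply: dconj_trans (dconj_s1 _) _; rewrite s1E s2E !eltM /=.
    apply: (dconj_elt_eq (shift (- (2 * a' + 1)) (2 * a' + 1 + 2 * b')
      (a' + 1) (- a' - b'))) => /=; ring.
  + have -> /= : odd `|(2 * a' + 1)%R|%N || odd `|(2 * b' + 1)%R|%N by lia.
    rewrite s0E.
    by apply: (dconj_elt_eq (shift (2 * a' + 1) (2 * b' + 1) (- a') (- b'))) => /=;
      ring.
Qed.

Lemma dconjP x y : dconj x y <-> class_of x = class_of y.
Proof.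
split=> [/class_dconj //|exy]; apply: dconj_trans (dconj_class_rep x) _.
by rewrite exy; exact/dconj_sym/dconj_class_rep.
Qed.

(** * The explicit families are delta-conjugacy classes *)

Lemma transQE p q : transQ p q = elt (2 * p - q) (2 * q - p) E.
Proof.
rewrite /transQ /trans /alpha1 /alpha2 !cowMz cowD /elt /=; congr Wext.
by congr pair; ring.
Qed.

(** The two added pieces of [hat X] consist of the delta-conjugates tau x tau and tau^2 x tau^2.
    They lie in the other two cosets of W_a, so it suffices to compare X with the class inside
    W_a. *)
Lemma hat_class (X : set wext) c :
  (forall x, X x -> class_of x = c) ->
  (forall (p q : int) u, class_of (elt (2 * p - q) (2 * q - p) u) = c ->
    X (elt (2 * p - q) (2 * q - p) u)) ->
  hat X = [set x | class_of x = c].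
Proof.
move=> Xc cX.
have [tau1 tau2 tau3x] : [/\
    forall x, (tau * x * tau^-1 * tau ^+ 2 = tau * x * tau)%g,
    forall x, (tau ^+ 2 * x * tau ^- 2 * tau = tau * (tau * x * tau) * tau)%g
  & forall x, (tau * (tau * (tau * x * tau) * tau) * tau = x)%g].
  move: tau tau3 => t t3; have tV : (t^-1 = t * t)%g.
    by apply: (mulgI t); rewrite mulgV mulgA.
  split=> x; rewrite -?expVgn ?expgS ?expg0 ?mulg1 ?tV.
  - by rewrite -!mulgA (mulgA t t t) t3 mulg1.
  - by rewrite -!mulgA (mulgA t t t) t3 mulg1.
  - by rewrite -!mulgA (mulgA t t t) t3 mulg1 !mulgA t3 mul1g.
(* Modulo 3 this is the class of the coweight modulo the root lattice. Since x -> tau x tau shifts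
   it by 2, exactly one of x, tau x tau, tau^2 x tau^2 lies in W_a. *)
pose degree x : int := (wtr x).1 - (wtr x).2.
have inX x : (3 %| degree x)%Z -> class_of x = c -> X x.
  case: (eltP x) => a b u /dvdzP[p ab]; rewrite /degree /= in ab.
  have [c1 [c2 [-> ->]]] : exists c1 c2 : int, a = 2 * c1 - c2 /\ b = 2 * c2 - c1.
    by exists (2 * p + b), (p + b); rewrite -[in LHS](subrK b a) ab; split; ring.
  exact: cX.
have deg_tau x : (3 %| degree (tau * x * tau)%g - degree x - 2)%Z.
  rewrite tauE /degree; case: (eltP x) => a b u; rewrite !eltM /=.
  by case: u => /=; lia.
apply/seteqP; split=> x /=.
  by case=> [[/Xc //|]|] [y /Xc yc <-]; rewrite ?tau1 ?tau2 ?class_tau.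
move=> xc; have [d0|] := boolP (3 %| degree x)%Z; first by left; left; exact: inX.
have := deg_tau x; have := deg_tau (tau * x * tau)%g => d1 d2 d0.
have [e|e] := boolP (3 %| degree (tau * x * tau)%g)%Z.
  by right; exists (tau * x * tau)%g; [apply: inX; rewrite ?class_tau|rewrite tau2 tau3x].
left; right; exists (tau * (tau * x * tau) * tau)%g; last by rewrite tau1 tau3x.
apply: inX; rewrite ?class_tau //; move: d1 d2 d0 e.
move: (degree _) (degree _) (degree _) => n1 n2 n3; lia.
Qed.

Lemma O1E : O1 = [set x | class_of x = Odd1].
Proof.
apply: hat_class => [x|p q u].
  by case=> -[a [b ->]]; rewrite transQE ?s1E ?s2E eltM class_elt.
rewrite class_elt; case: u => //= [_|_|].
- by left; exists p, q; rewrite transQE s1E eltM /=; congr elt; ring.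
- by right; exists p, q; rewrite transQE s2E eltM /=; congr elt; ring.
- by case: ifP.
Qed.

Lemma O0E : O0 = [set x | class_of x = Even 0].
Proof.
apply: hat_class => [x|p q u].
  by case=> [[|]|] [k _ <-];
    rewrite transQE ?s1E ?s2E ?eltM class_elt /=; congr Even; lia.
rewrite class_elt; case: u => //=; last by case: ifP.
- move=> [h]; right; exists p => //; rewrite transQE; congr elt; lia.
- move=> [h]; left; right; exists q => //.
  by rewrite transQE s1E s2E !eltM /=; congr elt; lia.
- move=> [h]; left; left; exists p => //.
  by rewrite transQE s1E s2E !eltM /=; congr elt; lia.
Qed.

(** Each family pairs an even finite part with a sign of the linear form measuring the glide; the
    floors enter through 2 lo + e = m = 2 hi - e. *)
Lemma OevenE m : Oeven m = [set x | class_of x = Even m].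
Proof.
apply: hat_class => [x|p q u].
  by case=> [[[[[|]|]|]|]|] [k _ <-];
    rewrite transQE ?s1E ?s2E ?eltM class_elt /=; congr Even; lia.
rewrite class_elt; case: u => //=; last by case: ifP.
- move=> [h].
  have [e|e] : p + q = m \/ p + q = - m%:Z by lia.
    by left; right; exists p => //; rewrite transQE; congr elt; lia.
  by right; exists (- q) => //; rewrite transQE; congr elt; lia.
- move=> [h].
  have [e|e] : 2 * q - p = m \/ 2 * q - p = - m%:Z by lia.
    left; left; left; right; exists (q - (uphalf m)%:Z) => //.
    rewrite transQE s1E s2E !eltM /=; congr elt; lia.
  left; left; right; exists (q + (m./2)%:Z) => //.
  rewrite transQE s1E s2E !eltM /=; congr elt; lia.
- move=> [h].
  have [e|e] : 2 * p - q = m \/ 2 * p - q = - m%:Z by lia.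
    do 4!left; right; exists (p - (uphalf m)%:Z) => //.
    rewrite transQE s1E s2E !eltM /=; congr elt; lia.
  do 5!left; exists (p + (m./2)%:Z) => //.
  rewrite transQE s1E s2E !eltM /=; congr elt; lia.
Qed.

(** * Trace functions *)

Definition qv : laurent := v - v^-1.

(* The value of [phi val] on elements of O_1 of length 2n+1; on elements of O_{2m}
   of length 2n the value is [even_coef val m + qv * odd_sum val n]. *)
Fixpoint odd_coef (val : wclass -> laurent) (n : nat) : laurent :=
  if n is n'.+1 then odd_coef val n' + qv * val (Even n) else val Odd1.

Fixpoint odd_sum (val : wclass -> laurent) (n : nat) : laurent :=
  if n is n'.+1 then odd_sum val n' + odd_coef val n' else 0.

(** Normalised so that [phi] equals [val (Even m)] at the minimal length 2m. *)
Definition even_coef (val : wclass -> laurent) (m : nat) : laurent :=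
  val (Even m) - qv * odd_sum val m.

(* Chosen so that f(a) := root_coef val |a - 1| satisfies f(2 - a) = f(a) and
   f(-a) - f(a) = qv * even_coef val a for a > 0: conjugation by s1 and s2 changes the
   sign of one <l, alpha> and permutes the other two, and tau permutes
   <l, alpha1>, <l, alpha2>, 2 - <l, alpha1 + alpha2>. *)
Fixpoint root_coef (val : wclass -> laurent) (j : nat) : laurent :=
  if j is (j'.+1 as j1).+1 then root_coef val j' + qv * even_coef val j1 else 0.

(** Its increments match the length-dependent part of [qv * phi] on glides; those of [root_coef]
    match the part depending on the class. *)
Fixpoint len_coef (val : wclass -> laurent) (n : nat) : laurent :=
  if n is n'.+1 then len_coef val n' + qv ^+ 2 * odd_sum val n else 0.

(* The other terms of [phi] contribute qv^2 * val Odd1 at s1 s2 s1. *)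
Definition half_coef (val : wclass -> laurent) (c : wclass) : laurent :=
  if c is Half0 then val Half0 - qv ^+ 2 * val Odd1 else val c.

Definition eltphi (val : wclass -> laurent) a b (u : fin6) (n : nat) : laurent :=
  match u with
  | W0 => half_coef val (eltclass a b W0)
      + (root_coef val `|(a - 1)%R| + root_coef val `|(b - 1)%R|
         + root_coef val `|(a + b - 1)%R|) + len_coef val n
  | _ => match eltclass a b u with
         | Even m => even_coef val m + qv * odd_sum val n
         | _ => odd_coef val n
         end
  end.

Definition phi (val : wclass -> laurent) (x : wext) : laurent :=
  eltphi val (wtr x).1 (wtr x).2 (fcode (wfin x)) (len x)./2.

Lemma phi_elt val a b u : phi val (elt a b u) = eltphi val a b u (elln a b u)./2.
Proof. by rewrite /phi /= fpermK len_elt. Qed.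

Lemma phi_tau val x : phi val (tau * x * tau)%g = phi val x.
Proof.
have len_t : len (tau * x * tau)%g = len x.
  rewrite !lenE tauE; case: (eltP x) => a b u; rewrite !eltM !ellE.
  by case: u => /=; lia.
have := class_tau x; move: len_t; rewrite !lenE tauE.
case: (eltP x) => a b u; rewrite !eltM !ellE !class_elt !phi_elt.
case: u => /= ->.
- by case=> ->.
- by [].
- by [].
- by case=> ->.
- by case=> ->.
- move=> ->; congr (_ + _ + _); rewrite -addrA addrC; congr (_ + _ + _);
    congr root_coef; lia.
Qed.

Lemma phi_min val x : (len x <= len (class_rep (class_of x)))%N ->
  phi val x = val (class_of x).
Proof.
rewrite !lenE; case: (eltP x) => a b u; rewrite class_elt phi_elt ellE.
(* At minimal length in the two half classes, all three arguments of [root_coef] are at most 1. *)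
have root01 j : (j <= 1)%N -> root_coef val j = 0 by case: j => [|[]].
case: u => /=.
- rewrite ellE /= => h.
  have -> : (`|a| + `|b| + `|(a + b)%R|)./2 = `|(a + b)%R|%N by lia.
  by rewrite /even_coef subrK.
- rewrite ellE /= => h; rewrite (_ : _./2 = 0%N) //.
  lia.
- rewrite ellE /= => h; rewrite (_ : _./2 = 0%N) //.
  lia.
- rewrite ellE /= => h; rewrite (_ : _./2 = `|b|%N) /even_coef ?subrK //.
  lia.
- rewrite ellE /= => h; rewrite (_ : _./2 = `|a|%N) /even_coef ?subrK //.
  lia.
- case: ifP => par /=; rewrite ?s0E ellE /= => h.
    have -> : (`|(a - 1)%R| + `|(b - 1)%R| + `|(a + b - 1)%R|)./2 = 0%N by lia.
    by rewrite !root01 ?addr0 //; lia.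
  have -> : (`|(a - 1)%R| + `|(b - 1)%R| + `|(a + b - 1)%R|)./2 = 1%N by lia.
  by rewrite !root01 /half_coef /= ?addr0 ?add0r ?subrK //; lia.
Qed.

(** Here and in the next two lemmas n, l1, l2 stand for the lengths of y, s0 y, y s0. When l1 and l2
    differ, y has minimal length 2m, so [phi] at y is [val (Even m)], which times [qv] is the
    increment of [odd_coef]. *)
Lemma odd_exchange val l1 l2 m n :
  l1 = l2 \/ n = (2 * m)%N /\ (l1.+1 = n /\ l2 = n.+1 \/ l2.+1 = n /\ l1 = n.+1) ->
  let c := qv * (even_coef val m + qv * odd_sum val n./2) in
  odd_coef val l1./2 + (if (l1 < n)%N then c else 0) =
  odd_coef val l2./2 + (if (l2 < n)%N then c else 0).
Proof.
have step k : odd_coef val k.+1 = odd_coef val k + qv * val (Even k.+1) by [].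
have half k : (2 * k.+1)./2 = k.+1 by lia.
case=> [-> //|[-> {n}]]; case: m => [|m]; first by case=> -[].
rewrite half /even_coef subrK => -[] [e1 e2].
- have -> : l1./2 = m by lia.
  have -> : l2./2 = m.+1 by lia.
  have -> : (l1 < 2 * m.+1)%N by lia.
  have -> : (l2 < 2 * m.+1)%N = false by lia.
  by rewrite step addr0.
- have -> : l2./2 = m by lia.
  have -> : l1./2 = m.+1 by lia.
  have -> : (l2 < 2 * m.+1)%N by lia.
  have -> : (l1 < 2 * m.+1)%N = false by lia.
  by rewrite step addr0.
Qed.

(** Now y is in O_1, and both products are in one even class; going from length n - 1 to n + 1 adds
    [odd_coef val n./2] to [odd_sum]. *)
Lemma even_exchange val l1 l2 m1 m2 n : m1 = m2 ->
  l1 = l2 \/ odd n /\ (l1.+1 = n /\ l2 = n.+1 \/ l2.+1 = n /\ l1 = n.+1) ->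
  let c := qv * odd_coef val n./2 in
  even_coef val m1 + qv * odd_sum val l1./2 + (if (l1 < n)%N then c else 0) =
  even_coef val m2 + qv * odd_sum val l2./2 + (if (l2 < n)%N then c else 0).
Proof.
have step k : odd_sum val k.+1 = odd_sum val k + odd_coef val k by [].
move=> <- [-> //|[on]] [] [e1 e2].
- have -> : l1./2 = n./2 by lia.
  have -> : l2./2 = n./2.+1 by lia.
  have -> : (l1 < n)%N by lia.
  have -> : (l2 < n)%N = false by lia.
  by rewrite step addr0 mulrDr addrA.
- have -> : l2./2 = n./2 by lia.
  have -> : l1./2 = n./2.+1 by lia.
  have -> : (l2 < n)%N by lia.
  have -> : (l1 < n)%N = false by lia.
  by rewrite step addr0 mulrDr addrA.
Qed.

(** Now y is a translation of glide m. Two root terms trade places; the third argument moves between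
    m - 1 and m + 1, which accounts for [qv * even_coef val m], and [len_coef] supplies the rest. *)
Lemma half_exchange val p1 p2 a1 a2 b1 b2 k1 k2 l1 l2 m n :
  p1 = p2 -> a1 = b2 -> b1 = a2 ->
  k1 = k2 /\ l1 = l2 \/
    ~~ odd n /\ ([/\ k2 = m.+1, m = k1.+1, l1.+1 = n & l2 = n.+1]
              \/ [/\ k1 = m.+1, m = k2.+1, l2.+1 = n & l1 = n.+1]) ->
  p1 + (root_coef val a1 + root_coef val b1 + root_coef val k1) + len_coef val l1./2
    + (if (l1 < n)%N then qv * (even_coef val m + qv * odd_sum val n./2) else 0) =
  p2 + (root_coef val a2 + root_coef val b2 + root_coef val k2) + len_coef val l2./2
    + (if (l2 < n)%N then qv * (even_coef val m + qv * odd_sum val n./2) else 0).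
Proof.
move=> -> -> -> [[-> ->]|[on]]; first by rewrite (addrC (root_coef val b2)).
case=> -[-> -> e1 e2].
- have -> : (l1 < n)%N by lia.
  have -> : (l2 < n)%N = false by lia.
  have -> : n./2 = l1./2.+1 by lia.
  have -> : l2./2 = l1./2.+1 by lia.
  by rewrite /=; ring.
- have -> : (l2 < n)%N by lia.
  have -> : (l1 < n)%N = false by lia.
  have -> : n./2 = l2./2.+1 by lia.
  have -> : l1./2 = l2./2.+1 by lia.
  by rewrite /=; ring.
Qed.

(** The twisted trace identity for T_(s0) and T_y; the conditional terms come from the quadratic
    relation. *)
Lemma phi_s0 val y :
  phi val (s0 * y)%g + (if (len (s0 * y)%g < len y)%N then qv * phi val y else 0) =
  phi val (y * s0)%g + (if (len (y * s0)%g < len y)%N then qv * phi val y else 0).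
Proof.
rewrite !lenE s0E; case: (eltP y) => a b u; rewrite !eltM !ellE !phi_elt.
case: u => /=.
- apply: half_exchange; try lia.
    by congr (half_coef _ (if _ then _ else _)); lia.
  have [m0|[m0|m0]] : a + b = 0 \/ 0 < a + b \/ a + b < 0 by lia.
  + by left; lia.
  + by right; split; [lia|left; split; lia].
  + by right; split; [lia|right; split; lia].
- apply: even_exchange; lia.
- apply: even_exchange; lia.
- apply: odd_exchange; lia.
- apply: odd_exchange; lia.
- congr (even_coef _ _ + qv * odd_sum _ _./2 + (if (_ < _)%N then _ else _)); lia.
Qed.

(** * The Hecke algebra *)

Lemma fsum_seq (I : choiceType) (V : nmodType) (s : seq I) (F : I -> V) :
  uniq s -> (forall i, i \notin s -> F i = 0) ->
  \sum_(i \in setT) F i = \sum_(i <- s) F i.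
Proof.
move=> us F0; rewrite (fsbigE s) //; last by move=> i _; exact: F0.
by apply: eq_bigl => i; rewrite in_setT.
Qed.

Lemma finite_seq_uniq (I : choiceType) (A : set I) :
  finite_set A -> exists2 s : seq I, uniq s & forall i, i \in s <-> A i.
Proof.
move=> /finite_seqP[s ->]; exists (undup s); first exact: undup_uniq.
by move=> i; rewrite mem_undup.
Qed.

Definition coord (H : hecke) (h : H) : wext -> laurent := sval (cid (T_basis h)).

Lemma coordP (H : hecke) (h : H) :
  finite_set [set w | coord h w != 0] /\ h = \sum_(w \in setT) coord h w *: T H w.
Proof. by rewrite /coord; case: cid => c []. Qed.

Lemma coord_seq (H : hecke) (h : H) : exists s : seq wext,
  [/\ uniq s, forall w, w \notin s -> coord h w = 0
    & h = \sum_(w <- s) coord h w *: T H w].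
Proof.
have [/finite_seq_uniq[s us sP] hE] := coordP h; exists s; split=> //.
  by move=> w; apply: contraNeq => ?; exact/sP.
rewrite {1}hE; apply: fsum_seq => // w ws.
by rewrite (_ : coord h w = 0) ?scale0r //; apply: contraNeq ws => ?; exact/sP.
Qed.

Lemma coord_uniq (H : hecke) (s : seq wext) (c : wext -> laurent) :
  uniq s -> (forall w, w \notin s -> c w = 0) ->
  coord (\sum_(w <- s) c w *: T H w) = c.
Proof.
move=> us c0; rewrite /coord; case: cid => c' /= [_ c'U]; apply: c'U; split.
  apply: (@sub_finite_set _ _ [set` s]) => [w /=|]; last exact: finite_seq.
  by apply: contraNT => /c0 ->.
by apply/esym/fsum_seq => // w /c0 ->; rewrite scale0r.
Qed.

Definition evalT (H : hecke) (f : wext -> laurent) (h : H) : laurent^o :=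
  \sum_(w \in setT) coord h w * f w.

Lemma evalT_sum (H : hecke) f (s : seq wext) (c : wext -> laurent) :
  uniq s -> (forall w, w \notin s -> c w = 0) ->
  evalT f (\sum_(w <- s) c w *: T H w) = \sum_(w <- s) c w * f w.
Proof.
move=> us c0; rewrite /evalT coord_uniq //.
by apply: fsum_seq => // w /c0 ->; rewrite mul0r.
Qed.

Lemma evalT_is_linear (H : hecke) f : linear (@evalT H f).
Proof.
move=> a h g; have [sh [_ h0 hE]] := coord_seq h; have [sg [_ g0 gE]] := coord_seq g.
pose s := undup (sh ++ sg); have us : uniq s by exact: undup_uniq.
have s0 w : w \notin s -> coord h w = 0 /\ coord g w = 0.
  by rewrite mem_undup mem_cat negb_or => /andP[/h0 -> /g0 ->].
have sumE u : (forall w, w \notin s -> coord u w = 0) ->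
    u = \sum_(w <- s) coord u w *: T H w.
  move=> u0; have [_ uE] := coordP u; rewrite {1}uE; apply: fsum_seq => // w /u0 ->.
  by rewrite scale0r.
have hE' : h = \sum_(w <- s) coord h w *: T H w by apply: sumE => w /s0[].
have gE' : g = \sum_(w <- s) coord g w *: T H w by apply: sumE => w /s0[].
have e : a *: h + g = \sum_(w <- s) (a * coord h w + coord g w) *: T H w.
  rewrite {1}hE' {1}gE' scaler_sumr -big_split; apply: eq_bigr => w _ /=.
  by rewrite scalerDl scalerA.
rewrite {}e [in X in _ = _ *: X + _]hE' [in X in _ = _ + X]gE'.
rewrite !evalT_sum //; last 3 first.
- by move=> w /s0[].
- by move=> w /s0[].
- by move=> w /s0[-> ->]; rewrite mulr0 addr0.
rewrite scaler_sumr -big_split; apply: eq_bigr => w _ /=.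
by rewrite mulrDl -mulrA.
Qed.

HB.instance Definition _ (H : hecke) f :=
  GRing.isLinear.Build laurent H (laurent^o) *:%R (@evalT H f) (@evalT_is_linear H f).

Lemma evalT_T (H : hecke) f w : evalT f (T H w) = f w.
Proof.
have := @evalT_sum H f [:: w] (fun x => (x == w)%:R) erefl.
rewrite !big_seq1 eqxx scale1r mul1r; apply=> x; rewrite inE.
by case: eqP.
Qed.

Lemma T_ind (H : hecke) (P : H -> Prop) :
  P 0 -> (forall a w h, P h -> P (a *: T H w + h)) -> forall h, P h.
Proof.
move=> P0 PT h; have [s [_ _ ->]] := coord_seq h.
elim: s => [|w s IH]; first by rewrite big_nil.
by rewrite big_cons; exact: PT.
Qed.

Lemma len_s0_mul y : len (s0 * y)%g = (len y).+1 \/ len y = (len (s0 * y)%g).+1.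
Proof.
rewrite !lenE s0E; case: (eltP y) => a b u; rewrite eltM !ellE.
by case: u => /=; lia.
Qed.

Lemma len_mul_s0 y : len (y * s0)%g = (len y).+1 \/ len y = (len (y * s0)%g).+1.
Proof.
rewrite !lenE s0E; case: (eltP y) => a b u; rewrite eltM !ellE.
by case: u => /=; lia.
Qed.

Lemma len_delta x : len (delta x) = len x.
Proof.
rewrite !lenE; case: (eltP x) => a b u; rewrite delta_elt !ellE.
by case: u => /=; lia.
Qed.

Lemma len_srefl i : len (srefl i) = 1%N.
Proof. by rewrite lenE; elim/ord3P: i; rewrite sreflE ?s0E ?s1E ?s2E ellE. Qed.

Lemma T_srefl_sq (H : hecke) i :
  T H (srefl i) * T H (srefl i) = qv *: T H (srefl i) + 1.
Proof.
have := T_quad H i; rewrite mulrBl !mulrDr -!scalerAr -!scalerAl !mulr1 !mul1r.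
rewrite scalerA mulVr ?v_unit // scale1r /qv scalerBl.
move=> /eqP; rewrite subr_eq0 => /eqP h.
apply: (addIr (v^-1 *: T H (srefl i))); rewrite h.
by rewrite addrAC subrK.
Qed.

Definition descent_coef (x y : wext) : laurent := if (len x < len y)%N then qv else 0.

Lemma T_s0_mul (H : hecke) y :
  T H s0 * T H y = T H (s0 * y)%g + descent_coef (s0 * y)%g y *: T H y.
Proof.
have l0 : len s0 = 1%N by rewrite -srefl0 len_srefl.
rewrite /descent_coef; have [e|e] := len_s0_mul y.
  rewrite (_ : (_ < _)%N = false) ?scale0r ?addr0; last by lia.
  by rewrite T_mul // l0 e.
rewrite ifT; last by lia.
have yE : y = (s0 * (s0 * y))%g by rewrite mulgA -srefl0 srefl_sq mul1g.
have lE : (len s0 + len (s0 * y)%g)%N = len (s0 * (s0 * y))%g.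
  by rewrite -yE l0 e.
have TyE : T H y = T H s0 * T H (s0 * y)%g by rewrite T_mul // -yE.
rewrite {1}TyE mulrA -srefl0 T_srefl_sq mulrDl mul1r -scalerAl srefl0 -TyE.
by rewrite addrC.
Qed.

Lemma T_mul_s0 (H : hecke) y :
  T H y * T H s0 = T H (y * s0)%g + descent_coef (y * s0)%g y *: T H y.
Proof.
have l0 : len s0 = 1%N by rewrite -srefl0 len_srefl.
rewrite /descent_coef; have [e|e] := len_mul_s0 y.
  rewrite (_ : (_ < _)%N = false) ?scale0r ?addr0; last by lia.
  by rewrite T_mul // l0 e addn1.
rewrite ifT; last by lia.
have yE : y = ((y * s0) * s0)%g by rewrite -mulgA -srefl0 srefl_sq mulg1.
have lE : (len (y * s0)%g + len s0)%N = len (y * s0 * s0)%g.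
  by rewrite -yE l0 addn1 e.
have TyE : T H y = T H (y * s0)%g * T H s0 by rewrite T_mul // -yE.
rewrite {1}TyE -mulrA -srefl0 T_srefl_sq mulrDr mulr1 -scalerAr srefl0 -TyE.
by rewrite addrC.
Qed.

Lemma len_tau : len tau = 0%N.
Proof. by rewrite lenE tauE ellE. Qed.

Lemma len_tauV : len (tau^-1)%g = 0%N.
Proof. by rewrite lenE tauVE ellE. Qed.

Lemma len_tau_mul x : len (tau * x)%g = len x.
Proof. by rewrite !lenE ell_tau. Qed.

Lemma len_mul_tauV x : len (x * tau^-1)%g = len x.
Proof.
rewrite !lenE tauVE; case: (eltP x) => a b u; rewrite eltM !ellE.
by case: u => /=; lia.
Qed.

(** Additivity of lengths makes T_1 a left identity on the basis; applying it to 1 gives the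
    claim. *)
Lemma T1 (H : hecke) : T H 1%g = 1.
Proof.
have l1 : len 1%g = 0%N by rewrite lenE oneE ellE.
have T1l h : T H 1%g * h = h.
  elim/T_ind: h => [|a w h IH]; first by rewrite mulr0.
  by rewrite mulrDr IH -scalerAr T_mul ?mul1g ?l1.
by rewrite -[LHS]mulr1 T1l.
Qed.

Lemma delta1 : delta 1%g = 1%g.
Proof. by rewrite oneE delta_elt. Qed.

(** The generators composing x are carried across one at a time, using [phi_s0] and [phi_tau]. *)
Lemma evalT_phi_comm (H : hecke) val x (h : H) :
  evalT (phi val) (T H x * h) = evalT (phi val) (h * T H (delta x)).
Proof.
elim/wext_gen_ind: x h => [h|x IH h|x IH h].
- by rewrite delta1 T1 mul1r mulr1.
- have good_s0 g : evalT (phi val) (T H s0 * g) = evalT (phi val) (g * T H s0).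
    elim/T_ind: g => [|a w g IHg]; first by rewrite mulr0 mul0r.
    rewrite mulrDr mulrDl -scalerAr -scalerAl !evalT_is_linear IHg.
    suff -> : evalT (phi val) (T H s0 * T H w) = evalT (phi val) (T H w * T H s0) by [].
    rewrite T_s0_mul T_mul_s0 !linearD !linearZ /= !evalT_T.
    have := phi_s0 val w; rewrite /descent_coef.
    by case: ifP => _; case: ifP => _ e; rewrite ?scale0r; exact: e.
  have ds : descent_coef (s0 * delta x)%g (delta x) = descent_coef (s0 * x)%g x.
    by rewrite -{1}delta_s0 -deltaM /descent_coef !len_delta.
  (* Lengths need not add in s0 y, hence the correction term; by [ds] it has the same coefficient
     for x and delta x. *)
  have TE y : T H (s0 * y)%g = T H s0 * T H y - descent_coef (s0 * y)%g y *: T H y.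
    by rewrite T_s0_mul addrK.
  rewrite deltaM delta_s0 !TE ds mulrBl mulrBr !linearB /=.
  rewrite -scalerAl -scalerAr !linearZ /= IH.
  by rewrite -mulrA good_s0 -mulrA IH mulrA.
- have good_tau g : evalT (phi val) (T H tau * g) = evalT (phi val) (g * T H (tau^-1)%g).
    elim/T_ind: g => [|a w g IHg]; first by rewrite mulr0 mul0r.
    rewrite mulrDr mulrDl -scalerAr -scalerAl !evalT_is_linear IHg.
    suff -> : evalT (phi val) (T H tau * T H w) =
              evalT (phi val) (T H w * T H (tau^-1)%g) by [].
    rewrite !T_mul ?len_mul_tauV ?len_tau_mul ?len_tauV ?len_tau ?addn0 //.
    have tK (t u : wext) : (t * (u * t^-1) * t = t * u)%g by rewrite mulgA mulgKV.
    by rewrite !evalT_T -(phi_tau val (w * tau^-1)%g) tK.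
  have dx : (delta (tau * x) = tau^-1 * delta x)%g by rewrite deltaM delta_tau.
  have lx : (len (tau^-1 * delta x)%g = len (delta x)).
    by rewrite -dx len_delta len_tau_mul len_delta.
  have -> : T H (tau * x)%g = T H tau * T H x.
    by rewrite T_mul // len_tau_mul len_tau.
  have -> : T H (delta (tau * x)%g) = T H (tau^-1)%g * T H (delta x).
    by rewrite dx T_mul // lx len_tauV.
  by rewrite -mulrA good_tau -mulrA IH mulrA.
Qed.

Lemma evalT_dcommutators (H : hecke) val (z : H) :
  dcommutators z -> evalT (phi val) z = 0.
Proof.
case=> s ->; rewrite linear_sum big1 // => -[[a h] h'] _ /=.
rewrite linearZ linearB /= (_ : _ - _ = 0) ?scaler0 //; apply/eqP.
rewrite subr_eq0; apply/eqP; elim/T_ind: h => [|b w h IH].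
  by rewrite linear0 mul0r mulr0.
rewrite mulrDl linearP -scalerAl mulrDr -scalerAr !evalT_is_linear IH.
by rewrite hdelta_T evalT_phi_comm.
Qed.

(** * Reduction in the twisted cocenter *)

Lemma dcommD (H : hecke) (x y : H) :
  dcommutators x -> dcommutators y -> dcommutators (x + y).
Proof. by case=> s -> [t ->]; exists (s ++ t); rewrite big_cat. Qed.

Lemma dcommZ (H : hecke) a (x : H) : dcommutators x -> dcommutators (a *: x).
Proof.
case=> s ->; exists [seq (a * p.1.1, p.1.2, p.2) | p <- s].
by rewrite big_map scaler_sumr; apply: eq_bigr => p _ /=; rewrite scalerA.
Qed.

Lemma dcomm_intro (H : hecke) (h h' : H) : dcommutators (h * h' - h' * hdelta H h).
Proof. by exists [:: (1, h, h')]; rewrite big_seq1 scale1r. Qed.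

Definition dcong (H : hecke) (x y : H) : Prop := dcommutators (x - y).

Lemma dcong_refl (H : hecke) (x : H) : dcong x x.
Proof. by rewrite /dcong subrr; exists [::]; rewrite big_nil. Qed.

Lemma dcong_sym (H : hecke) (x y : H) : dcong x y -> dcong y x.
Proof. by move=> /(dcommZ (-1)); rewrite scaleN1r opprB. Qed.

Lemma dcong_trans (H : hecke) (x y z : H) : dcong x y -> dcong y z -> dcong x z.
Proof. by move=> xy yz; have := dcommD xy yz; rewrite addrA subrK. Qed.

Lemma dcongD (H : hecke) (x y x' y' : H) :
  dcong x y -> dcong x' y' -> dcong (x + x') (y + y').
Proof. by move=> xy xy'; have := dcommD xy xy'; rewrite addrACA -opprD. Qed.

Lemma dcongZ (H : hecke) a (x y : H) : dcong x y -> dcong (a *: x) (a *: y).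
Proof. by move=> /(dcommZ a); rewrite scalerBr. Qed.

Lemma dcong_sum (H : hecke) (I : eqType) (s : seq I) (F G : I -> H) :
  (forall i, i \in s -> dcong (F i) (G i)) ->
  dcong (\sum_(i <- s) F i) (\sum_(i <- s) G i).
Proof.
elim: s => [|i s IH] FG; first by rewrite !big_nil; exact: dcong_refl.
rewrite !big_cons; apply: dcongD; first by apply: FG; rewrite inE eqxx.
by apply: IH => j js; apply: FG; rewrite inE js orbT.
Qed.

Lemma dcong_delta (H : hecke) x : dcong (T H x) (T H (delta x)).
Proof. by have := dcomm_intro (T H x) 1; rewrite mulr1 mul1r hdelta_T. Qed.

Lemma dcong_tau (H : hecke) x : dcong (T H x) (T H (tau * x * tau)%g).
Proof.
apply: dcong_sym; have := dcomm_intro (T H tau) (T H (x * tau)%g).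
have tK (t u : wext) : ((u * t) * t^-1 = u)%g by rewrite mulgK.
rewrite hdelta_T delta_tau !T_mul; first by rewrite tK mulgA.
- by rewrite len_mul_tauV len_tauV addn0.
- by rewrite len_tau_mul len_tau.
Qed.

Lemma dcong_srefl (H : hecke) i j y : delta (srefl i) = srefl j ->
  len (srefl i * y)%g = (len y).+1 -> len (y * srefl j)%g = (len y).+1 ->
  dcong (T H (srefl i * y)%g) (T H (y * srefl j)%g).
Proof.
move=> dij li lj; have := dcomm_intro (T H (srefl i)) (T H y).
by rewrite hdelta_T dij !T_mul // ?li ?lj len_srefl ?addn1.
Qed.

(** Moving the left factor to the right turns it into a second T_(s_j), and the quadratic relation
    expands the square. *)
Lemma dcong_descent (H : hecke) i j y : delta (srefl i) = srefl j ->
  len (y * srefl j)%g = (len y).+1 ->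
  len (srefl i * (y * srefl j))%g = (len y).+2 ->
  dcong (T H (srefl i * (y * srefl j))%g) (T H y + qv *: T H (y * srefl j)%g).
Proof.
move=> dij lj lij; have := dcomm_intro (T H (srefl i)) (T H (y * srefl j)%g).
rewrite hdelta_T dij T_mul ?lij ?lj ?len_srefl //.
have e : T H (y * srefl j)%g = T H y * T H (srefl j).
  by rewrite T_mul // len_srefl lj addn1.
rewrite (_ : T H (y * srefl j)%g * _ = T H y + qv *: T H (y * srefl j)%g) //.
by rewrite {1}e -mulrA T_srefl_sq mulrDr mulr1 -scalerAr -e addrC.
Qed.

Lemma dcong_tau2 (H : hecke) x : dcong (T H x) (T H (tau * (tau * x * tau) * tau)%g).
Proof. exact: dcong_trans (dcong_tau H x) (dcong_tau H _). Qed.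

(** Since [tau] has length 0, T_x is congruent to T_(tau x tau); at most two such moves make the
    finite part trivial. *)
Lemma dcong_tau_even (H : hecke) x m : class_of x = Even m ->
  exists a b, [/\ dcong (T H x) (T H (elt a b E)), `|(a + b)%R|%N = m
              & len x = len (elt a b E)].
Proof.
case: (eltP x) => a b u; rewrite class_elt; case: u => //=.
- by case=> <-; exists a, b; split=> //; exact: dcong_refl.
- case=> <-; exists (1 - (a + b)), (a - 1); split; last by rewrite !len_elt /=; lia.
    have := dcong_tau H (elt a b S12); rewrite tauE !eltM /=.
    by congr (dcong _ (T H (elt _ _ _))); ring.
  lia.
- case=> <-; exists (b - 1), (1 - a - b); split; last by rewrite !len_elt /=; lia.
    have := dcong_tau2 H (elt a b S21); rewrite tauE !eltM /=.
    by congr (dcong _ (T H (elt _ _ _))); ring.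
  lia.
- by case: ifP.
Qed.

(** Only length-preserving moves are used: a shift by s2 and s1, then two by [tau], lead from (a +
    1, b) to (-b - 1, -a), and a shift by [s0] leads to (a, b + 1). *)
Lemma dcong_even_step (H : hecke) (a b : nat) :
  dcong (T H (elt a.+1 b E)) (T H (elt a b.+1 E)).
Proof.
have d20 : delta (srefl 2) = srefl 1 by rewrite sreflE delta_s2.
have d00 : delta (srefl 0) = srefl 0 by rewrite sreflE delta_s0.
apply: (@dcong_trans _ _ (T H (elt (- b%:Z - 1) (- a%:Z) E))).
  have := @dcong_srefl H 2 1 (elt a.+1 b S1) d20.
  rewrite !sreflE s1E s2E !eltM !len_elt /= => h.
  have {h} h := dcong_sym (h _ _).
  have := dcong_trans (h ltac:(lia) ltac:(lia)) (dcong_tau2 H _).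
  rewrite tauE !eltM /=.
  by congr (dcong (T H (elt _ _ _)) (T H (elt _ _ _))); lia.
have := @dcong_srefl H 0 0 (elt (- b%:Z) (1 - a%:Z) W0) d00.
rewrite !sreflE s0E !eltM !len_elt /= => h.
have {h} := dcong_sym (h ltac:(lia) ltac:(lia)).
by congr (dcong (T H (elt _ _ _)) (T H (elt _ _ _))); lia.
Qed.

Lemma dcong_even_min (H : hecke) x m :
  class_of x = Even m -> (len x <= 2 * m)%N -> dcong (T H x) (T H (elt 0 m E)).
Proof.
move=> /(dcong_tau_even H)[a [b [xab abm ->]]]; rewrite len_elt /= => le.
apply: dcong_trans xab _.
have pos (i j : nat) : dcong (T H (elt i j E)) (T H (elt 0 (i + j)%N E)).
  elim: i j => [|i IH] j; first exact: dcong_refl.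
  by apply: dcong_trans (dcong_even_step H i j) _; rewrite addSnnS.
(* The length bound reads |a| + |b| <= |a + b|, so a and b do not have opposite signs. *)
have [[a0 b0]|[a0 b0]] : 0 <= a /\ 0 <= b \/ a <= 0 /\ b <= 0 /\ a + b < 0 by lia.
  have := pos `|a|%N `|b|%N.
  by congr (dcong (T H (elt _ _ _)) (T H (elt _ _ _))); lia.
apply: (@dcong_trans _ _ (T H (elt (- b) (- a) E))); last first.
  rewrite (_ : - b = `|b|%N) 1?(_ : - a = `|a|%N) 1?(_ : m = (`|b| + `|a|)%N).
  - exact: pos.
  - lia.
  - lia.
  - lia.
have := @dcong_srefl H 0 0 (elt (a + 1) (b + 1) W0).
rewrite sreflE delta_s0 s0E !eltM !len_elt /= => h.
have := dcong_sym (h erefl ltac:(lia) ltac:(lia)).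
by congr (dcong (T H (elt _ _ _)) (T H (elt _ _ _))); lia.
Qed.

Lemma dcong_odd_min (H : hecke) x :
  class_of x = Odd1 -> (len x <= 1)%N -> dcong (T H x) (T H (elt 0 1 S2)).
Proof.
have S1min a b : (`|(a - 1)%R| + `|b| + `|(a + b)%R| <= 1)%N ->
    dcong (T H (elt a b S1)) (T H (elt 1 0 S1)).
  move=> le.
  have e1 : dcong (T H (elt 1 (-1) S1)) (T H (elt 1 0 S1)).
    by have := dcong_tau H (elt 1 (-1) S1); rewrite tauE !eltM.
  have e0 : dcong (T H (elt 0 0 S1)) (T H (elt 1 0 S1)).
    by apply: dcong_trans e1; have := dcong_tau H (elt 0 0 S1); rewrite tauE !eltM.
  (* These length-one elements form one orbit under x -> tau x tau. *)
  have : (a = 0 /\ b = 0) \/ (a = 1 /\ b = -1) \/ (a = 1 /\ b = 0) by lia.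
  by case=> [|[]] [-> ->] //; exact: dcong_refl.
have S12 : dcong (T H (elt 1 0 S1)) (T H (elt 0 1 S2)).
  by have := dcong_delta H (elt 1 0 S1); rewrite delta_elt.
case: (eltP x) => a b u; rewrite class_elt len_elt.
case: u => //= [_|_|]; last by case: ifP.
  by move=> /S1min /dcong_trans; exact.
move=> le; apply: dcong_trans S12; have := dcong_delta H (elt a b S2).
rewrite delta_elt => /dcong_trans; apply; apply: S1min; lia.
Qed.

(* glide m has minimal length 2m in O_{2m}; rotation n lies in O_1 and has length
   2n + 1. *)
Definition glide (m : nat) : wext := elt 0 m E.
Definition rotation (n : nat) : wext := elt 0 n.+1 S2.

Lemma dcong_rot (H : hecke) n :
  dcong (T H (rotation n.+1)) (T H (rotation n) + qv *: T H (glide n.+1)).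
Proof.
have d00 : delta (srefl 0) = srefl 0 by rewrite sreflE delta_s0.
have d12 : delta (srefl 1) = srefl 2 by rewrite sreflE delta_s1.
(* The intermediate element is [s1 * (rotation n * s2)], where [rotation n * s2] is [glide n.+1]; a
   shift by [s0] and two by [tau] reach it. *)
apply: (@dcong_trans _ _ (T H (elt 0 n.+1 S1))).
  have := @dcong_srefl H 0 0 (elt (- n.+1%:Z) 1 S21) d00.
  rewrite !sreflE s0E !eltM !len_elt /= => h.
  have := dcong_trans (h ltac:(lia) ltac:(lia)) (dcong_tau2 H _).
  rewrite tauE !eltM /rotation /=.
  by congr (dcong (T H (elt _ _ _)) (T H (elt _ _ _))); lia.
have := @dcong_descent H 1 2 (elt 0 n.+1 S2) d12.
rewrite !sreflE s1E s2E !eltM !len_elt /= => h.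
have := h ltac:(lia) ltac:(lia).
by congr (dcong (T H (elt _ _ _)) (T H (elt _ _ _) + _ *: T H (elt _ _ _))); lia.
Qed.

Lemma dcong_refl_step (H : hecke) (n : nat) :
  dcong (T H (elt n.+1 (- n.+1%:Z) E)) (T H (elt n (- n%:Z) E) + qv *: T H (rotation n)).
Proof.
have d21 : delta (srefl 2) = srefl 1 by rewrite sreflE delta_s2.
(* The left side is [s2 * rotation n], and [rotation n] is y s1 for this y; two moves by [tau] turn
   y into the translation by (n, -n). *)
have := @dcong_descent H 2 1 (elt 0 n.+1 S21) d21.
rewrite !sreflE s1E s2E !eltM !len_elt /= => h.
apply: (dcong_trans (y := T H (elt 0 n.+1 S21) + qv *: T H (rotation n))).
  have := h ltac:(lia) ltac:(lia).
  by congr (dcong (T H (elt _ _ _)) (_ + _ *: T H (elt _ _ _))); lia.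
apply: dcongD; last exact: dcong_refl.
have := dcong_tau2 H (elt 0 n.+1 S21); rewrite tauE !eltM /=.
by congr (dcong _ (T H (elt _ _ _))); lia.
Qed.

Lemma dcong_rot_expand (H : hecke) n :
  dcong (T H (rotation n)) (T H (rotation 0) + qv *: \sum_(1 <= j < n.+1) T H (glide j)).
Proof.
elim: n => [|n IH]; first by rewrite big_geq // scaler0 addr0; exact: dcong_refl.
apply: dcong_trans (dcong_rot H n) _.
rewrite big_nat_recr //= scalerDr addrA; apply: dcongD => //.
exact: dcong_refl.
Qed.

(** Iteration yields [qv] times each rotation i with i < k, and rotation i contributes [qv] times
    each glide j with 1 <= j <= i. Hence rotation 0 occurs k times and glide j occurs k - j
    times. *)
Lemma dcong_refl_expand (H : hecke) (k : nat) :
  dcong (T H (elt k (- k%:Z) E))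
    (T H (glide 0) + (k%:R * qv) *: T H (rotation 0)
     + \sum_(1 <= j < k) ((k - j)%:R * qv ^+ 2) *: T H (glide j)).
Proof.
elim: k => [|k IH].
  by rewrite big_geq // mul0r scale0r !addr0; exact: dcong_refl.
apply: dcong_trans (dcong_refl_step H k) _.
apply: dcong_trans (dcongD IH (dcongZ qv (dcong_rot_expand H k))) _.
set S := \sum_(1 <= j < k.+1) T H (glide j).
rewrite (_ : _ + qv *: _ = T H (glide 0) + (k.+1%:R * qv) *: T H (rotation 0)
     + \sum_(1 <= j < k.+1) ((k.+1 - j)%:R * qv ^+ 2) *: T H (glide j)).
  exact: dcong_refl.
have -> : \sum_(1 <= j < k.+1) ((k.+1 - j)%:R * qv ^+ 2) *: T H (glide j) =
    \sum_(1 <= j < k) ((k - j)%:R * qv ^+ 2) *: T H (glide j) + qv ^+ 2 *: S.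
  (* The added term j = k has coefficient 0. *)
  have -> : \sum_(1 <= j < k) ((k - j)%:R * qv ^+ 2) *: T H (glide j) =
      \sum_(1 <= j < k.+1) ((k - j)%:R * qv ^+ 2) *: T H (glide j).
    case: k {IH S} => [|k]; first by rewrite !big_geq.
    by rewrite [RHS]big_nat_recr //= subnn mul0r scale0r addr0.
  rewrite /S scaler_sumr -big_split /=; apply: eq_big_nat => j /andP[_ jk].
  by rewrite -scalerDl subSn // -natr1 mulrDl mul1r.
rewrite scalerDr scalerA -expr2 -natr1 mulrDl mul1r [(_ + qv) *: _]scalerDl.
by rewrite addrACA !addrA.
Qed.

(** * Class polynomials *)

Definition class_set (c : wclass) : set wext := [set x | class_of x = c].

Lemma class_of_rep c : class_of (class_rep c) = c.
Proof. by case: c => [m|||]; rewrite /= ?s0E class_elt. Qed.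

Lemma class_set_inj : injective class_set.
Proof.
move=> c d cd; have : class_set c (class_rep c) by exact: class_of_rep.
by rewrite cd => <-; rewrite class_of_rep.
Qed.

Lemma dclass_eq x : [set y | dconj x y] = class_set (class_of x).
Proof.
by apply/seteqP; split=> y /=; [move/dconjP/esym|move/esym/dconjP].
Qed.

Lemma dclassesP O : dclasses O <-> exists c, O = class_set c.
Proof.
split=> [[x _ <-]|[c ->]]; first by exists (class_of x); exact: dclass_eq.
by exists (class_rep c) => //; rewrite dclass_eq class_of_rep.
Qed.

Lemma dclasses_class_set c : dclasses (class_set c).
Proof. by apply/dclassesP; exists c. Qed.

Lemma min_repsP r c : min_reps r ->
  class_of (r (class_set c)) = c /\
  (len (r (class_set c)) <= len (class_rep c))%N.
Proof.
move=> /(_ _ (dclasses_class_set c))[rc min]; split=> //; apply: min.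
exact: class_of_rep.
Qed.

Lemma dcong_even_rep (H : hecke) r m : min_reps r ->
  dcong (T H (glide m)) (T H (r (class_set (Even m)))).
Proof.
move=> mr; have [rc lr] := min_repsP (Even m) mr; apply/dcong_sym/dcong_even_min => //.
by apply: leq_trans lr _; rewrite len_elt /=; lia.
Qed.

Lemma dcong_odd_rep (H : hecke) r : min_reps r ->
  dcong (T H (rotation 0)) (T H (r (class_set Odd1))).
Proof.
move=> mr; have [rc lr] := min_repsP Odd1 mr; apply/dcong_sym/dcong_odd_min => //.
by apply: leq_trans lr _; rewrite len_elt.
Qed.

Lemma fsum_dclasses (V : nmodType) (s : seq (set wext)) (F : set wext -> V) :
  uniq s -> (forall O, O \in s -> dclasses O) ->
  (forall O, dclasses O -> O \notin s -> F O = 0) ->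
  \sum_(O \in dclasses) F O = \sum_(O <- s) F O.
Proof.
move=> us sd F0; rewrite (fsbigE s) //.
rewrite [LHS]big_seq_cond [RHS]big_seq_cond; apply: eq_bigl => O.
by have [Os|] := boolP (O \in s) => //=; rewrite mem_set //; exact: sd.
Qed.

(** The trace function [phi] for the indicator of one class kills the twisted commutators and,
    evaluated on minimal representatives, isolates the coefficient of that class. *)
Lemma class_polynomials_uniq (H : hecke) r w f g : min_reps r ->
  class_polynomials H r w f -> class_polynomials H r w g ->
  forall O, dclasses O -> f O = g O.
Proof.
move=> mr [ff fT] [fg gT] _ /dclassesP[c ->].
have /finite_seq_uniq[s us sP] : finite_set
    ([set O | dclasses O /\ f O != 0] `|` [set O | dclasses O /\ g O != 0]).
  by rewrite finite_setU.
have sd O : O \in s -> dclasses O by move=> /sP[[]|[]].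
have s0 h O : h = f \/ h = g -> dclasses O -> O \notin s -> h O *: T H (r O) = 0.
  move=> hfg dO; have [-> _|hO] := eqVneq (h O) 0; first by rewrite scale0r.
  by case/negP; apply/sP; case: hfg hO => ->; [left|right].
have fgT : dcong (\sum_(O <- s) f O *: T H (r O)) (\sum_(O <- s) g O *: T H (r O)).
  move: fT gT; rewrite !(@fsum_dclasses _ s) //.
  - by move=> /dcong_sym /dcong_trans h /h.
  - by move=> O; apply: s0; right.
  - by move=> O; apply: s0; left.
pose val d : laurent := `[< d = c >]%:R.
have phi_r O : O \in s -> phi val (r O) = `[< O = class_set c >]%:R.
  move=> Os; have /dclassesP[d ->] := sd O Os; have [rd ld] := min_repsP d mr.
  rewrite phi_min rd // /val; congr (nat_of_bool _)%:R.
  by apply/asboolP/asboolP => [->//|/class_set_inj].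
have ev h : evalT (phi val) (\sum_(O <- s) h O *: T H (r O)) =
    if class_set c \in s then h (class_set c) else 0.
  rewrite linear_sum big_seq; under eq_bigr => O Os.
    rewrite linearZ /= evalT_T phi_r //; over.
  rewrite -big_seq; case: ifP => cs.
    rewrite (bigD1_seq (class_set c)) //= asboolT // big1 ?addr0.
      exact: mulr1.
    by move=> O /eqP Oc; rewrite asboolF // scaler0.
  rewrite big_seq big1 // => O Os; rewrite asboolF ?scaler0 // => Oc.
  by move: Os; rewrite Oc cs.
have := evalT_dcommutators val fgT; rewrite linearB /= !ev.
case: ifPn => cs; first by move=> /eqP; rewrite subr_eq0 => /eqP.
have z h : h = f \/ h = g -> h (class_set c) = 0.
  move=> hfg; apply: contraNeq cs => hc; apply/sP.
  have dc := dclasses_class_set c.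
  by case: hfg hc => ->; [left|right].
by rewrite !z; [|right|left].
Qed.

Lemma class_polynomials_intro (H : hecke) r w k f : min_reps r ->
  class_of w = Even 0 -> len w = (2 * k)%N ->
  [/\ forall j, (1 <= j <= k.-1)%N ->
        f (class_set (Even j)) = (k - j)%:R * qv ^+ 2,
      f (class_set Odd1) = k%:R * qv,
      f (class_set (Even 0)) = 1 &
      forall O, dclasses O ->
        (forall j, (1 <= j <= k.-1)%N -> O <> class_set (Even j)) ->
        O <> class_set Odd1 -> O <> class_set (Even 0) -> f O = 0] ->
  class_polynomials H r w f.
Proof.
move=> mr wc wl [fe fo f0 fz].
pose s := class_set (Even 0) :: class_set Odd1 ::
  [seq class_set (Even j) | j <- index_iota 1 k].
have us : uniq s.
  rewrite /= map_inj_uniq ?iota_uniq => [|i j /class_set_inj[] //].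
  rewrite andbT inE negb_or -andbA; apply/and3P; split.
  - by apply/eqP => /class_set_inj.
  - by apply/mapP => -[j + /class_set_inj[j0]]; rewrite -j0 mem_index_iota.
  - by apply/mapP => -[j _ /class_set_inj].
have sd O : O \in s -> dclasses O.
  rewrite !inE => /orP[/eqP ->|/orP[/eqP ->|/mapP[j _ ->]]];
    exact: dclasses_class_set.
have s0 O : dclasses O -> O \notin s -> f O = 0.
  move=> dO /negP Os; apply: fz => // [j jk Oj|Oj|Oj]; apply: Os; rewrite Oj.
  - rewrite !in_cons; apply/orP; right; apply/orP; right; apply/mapP; exists j => //.
    by rewrite mem_index_iota; lia.
  - by rewrite in_cons mem_head orbT.
  - exact: mem_head.
split.
  apply: (@sub_finite_set _ _ [set` s]); last exact: finite_seq.
  by move=> O /= [dO]; apply: contraNT => /(s0 O dO) ->.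
rewrite (@fsum_dclasses _ s) //; last first.
  by move=> O dO /(s0 O dO) ->; rewrite scale0r.
rewrite !big_cons big_map f0 fo scale1r.
have [a [b [wab ab wl']]] := dcong_tau_even H wc.
apply: dcong_trans wab _; move: wl; rewrite wl' len_elt /= => abk.
apply: (dcong_trans (y := T H (elt k (- k%:Z) E))).
  (* Glide 0 and length 2k leave only the translations by (k, -k) and (-k, k), which [delta]
     exchanges. *)
  have [a0|a0] := lerP 0 a.
    have -> : b = - k%:Z by lia.
    have -> : a = k by lia.
    exact: dcong_refl.
  have -> : b = k by lia.
  have -> : a = - k%:Z by lia.
  by have := dcong_delta H (elt (- k%:Z) k E); rewrite delta_elt.
apply: dcong_trans (dcong_refl_expand H k) _; rewrite -addrA.
apply: dcongD; first exact: dcong_even_rep.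
apply: dcongD; first by apply: dcongZ; exact: dcong_odd_rep.
apply: dcong_sum => j; rewrite mem_index_iota => jk.
by rewrite fe; [apply: dcongZ; exact: dcong_even_rep|lia].
Qed.

Theorem proposition2p45 (H : hecke) (r : set wext -> wext) (w : wext) (k : nat) :
  min_reps r -> O0 w -> len w = (2 * k)%N ->
  forall f : set wext -> laurent,
    class_polynomials H r w f <->
    [/\ forall j, (1 <= j <= k.-1)%N ->
          f (Oeven j) = (k - j)%:R * (v - v^-1) ^+ 2,
        f O1 = k%:R * (v - v^-1),
        f O0 = 1 &
        forall O, dclasses O ->
          (forall j, (1 <= j <= k.-1)%N -> O <> Oeven j) ->
          O <> O1 -> O <> O0 -> f O = 0].
Proof.
have -> : Oeven = class_set \o Even by apply/funext => m; exact: OevenE.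
rewrite O1E O0E => mr wc wl f; split; last exact: class_polynomials_intro.
(* An explicit solution, to which uniqueness compares f; as a function of sets, it reads the class
   off the representative [r O]. *)
pose g O : laurent :=
  match class_of (r O) with
  | Even 0 => 1
  | Even j => if (j <= k.-1)%N then (k - j)%:R * qv ^+ 2 else 0
  | Odd1 => k%:R * qv
  | _ => 0
  end.
have gE c : g (class_set c) =
    match c with
    | Even 0 => 1
    | Even j => if (j <= k.-1)%N then (k - j)%:R * qv ^+ 2 else 0
    | Odd1 => k%:R * qv
    | _ => 0
    end by rewrite /g (min_repsP c mr).1.
have gH : class_polynomials H r w g.
  apply: class_polynomials_intro mr wc wl _; split.
  - by move=> j jk; rewrite gE; case: j jk => // j /andP[_ ->].
  - exact: gE.
  - exact: gE.
  - move=> _ /dclassesP[[[|j]|||] ->] // h; rewrite gE //.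
    by case: ifP => // jk; case: (h j.+1).
move=> fH; have fg c : f (class_set c) = g (class_set c).
  exact: class_polynomials_uniq mr fH gH _ (dclasses_class_set c).
split=> [j jk|||O /dclassesP[c ->] he ho h0]; rewrite /= fg gE //.
- by case: j jk => // j /andP[_ ->].
- case: c he ho h0 => [[|j]|||] // he.
  by case: ifP => // jk; case: (he j.+1).
Qed.
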